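(* Let $X\subseteq\mathbb{R}^n$ and $\Theta\subseteq\mathbb{R}^p$ be nonempty closed convex sets, let $f$ (on $X\times\Theta$, differentiable in $x$) and $h$ (on $\Theta$, differentiable) satisfy the gradient specifications listed in the context, let the step sizes $\{\gamma_k\},\{\beta_k\}$ satisfy the step-size conditions listed in the context, let $\theta^*=\operatorname{argmin}_{\theta\in\Theta}h(\theta)$, and assume that $\min_{x\in X}f(x,\theta^* )$ is attained. Let $Q\ge1$ and $R\ge1$ be integers, and let $\{x_k\},\{\theta_k\}$ be the random sequences generated from $x_0\in X$, $\theta_0\in\Theta$ by the multi-step learning–optimization scheme described in the context, which alternates between $Q$ outer-level optimization steps and $R$ inner-level learning updates, with noise satisfying the moment conditions listed in the context. Then, almost surely, $\{x_{k+1}\}$ converges to a point $x^*\in X$ that satisfies the first-order (KKT) stationarity conditions for the problem $\min_{x\in X}f(x,\theta^* )$, i.e. $\nabla f(x^*,\theta^* )^T(x-x^* )\ge0$ for all $x\in X$.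
   Context: $\|\cdot\|$ is the Euclidean norm, $\Pi_S$ is Euclidean projection onto a closed convex set $S$, and $\nabla f(x,\theta)$ denotes the gradient of $f$ with respect to $x$. Multi-step scheme: for each $k\ge0$, set $x_k^0=x_k$, $\theta_k^0=\theta_k$; for $j=0,\dots,Q-1$, $$x_k^{j+1/2}=\Pi_X(x_k^j-\gamma_k\nabla f(x_k^j,\theta_k)),\qquad x_k^{j+1}=\Pi_X(x_k^j-\gamma_k\nabla f(x_k^{j+1/2},\theta_k));$$ for $i=0,\dots,R-1$, $$\theta_k^{i+1}=\Pi_\Theta\left(\theta_k^i-\beta_k(\nabla h(\theta_k^i)+w_k^i)\right);$$ and $x_{k+1}=x_k^Q$, $\theta_{k+1}=\theta_k^R$. Noise: let $\mathcal{F}_k=\sigma(x_0,\theta_0,\dots,x_k,\theta_k)$ and $\mathcal{M}_k^i=\sigma(\mathcal{F}_k,w_k^0,\theta_k^1,w_k^1,\dots,w_k^{i-1},\theta_k^i)$ (so $\mathcal{M}_k^0=\mathcal{F}_k$). For all $k$ and $0\le i\le R-1$, $\mathbb{E}[w_k^i\mid\mathcal{M}_k^i]=0$ and $\mathbb{E}[\|w_k^i\|^2\mid\mathcal{M}_k^i]\le\nu^2$ for a constant $\nu>0$. Step-size conditions: $\gamma_k,\beta_k>0$ deterministic; $\sum_k\gamma_k=\infty$, $\sum_k\gamma_k^2<\infty$; $\sum_k\beta_k=\infty$, $\sum_k\beta_k^2<\infty$; $\beta_k\le\beta_0\le 2\mu_h/L_h^2$ for all $k$; and for some $\tau\in(0,1)$,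 $\sum_k\gamma_k^{2-\tau}<\infty$ and $\lim_{k\to\infty}\gamma_k^\tau/\beta_k=0$. Gradient specifications: (a) for each $\theta\in\Theta$, $f(\cdot,\theta)$ is pseudoconvex on $X$, i.e. for $x_1,x_2\in X$, $\nabla f(x_1,\theta)^T(x_2-x_1)\ge0$ implies $f(x_2,\theta)\ge f(x_1,\theta)$. (b) $h$ is strongly convex with parameter $\mu_h>0$: $(\nabla h(\theta_1)-\nabla h(\theta_2))^T(\theta_1-\theta_2)\ge\mu_h\|\theta_1-\theta_2\|^2$ for all $\theta_1,\theta_2\in\Theta$. (c) For positive constants $L_f,L_\theta,L_h$ and all $x,x_1,x_2\in X$, $\theta,\theta_1,\theta_2\in\Theta$: $\|\nabla f(x_1,\theta)-\nabla f(x_2,\theta)\|\le L_f\|x_1-x_2\|$, $\|\nabla f(x,\theta_1)-\nabla f(x,\theta_2)\|\le L_\theta\|\theta_1-\theta_2\|$, $\|\nabla h(\theta_1)-\nabla h(\theta_2)\|\le L_h\|\theta_1-\theta_2\|$; moreover $\|\nabla f(x,\theta^* )\|\le B$ for all $x\in X$, for some $B>0$. The limit $x^*$ may depend on the sample path. *)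

(* Defs.v *)
From HB Require Import structures.
From mathcomp Require Import all_boot all_order all_algebra.
From mathcomp Require Import all_classical all_reals all_analysis.

Set Implicit Arguments.
Unset Strict Implicit.
Unset Printing Implicit Defensive.

Import Order.TTheory GRing.Theory Num.Theory.
Import numFieldNormedType.Exports.

Local Open Scope classical_set_scope.
Local Open Scope ring_scope.

Definition dotv (R : realType) (n : nat) (u v : 'rV[R]_n) : R :=
  \sum_(i < n) u 0 i * v 0 i.

(* The norm [`|u|] that the library puts on ['rV[R]_n] is the sup norm; it
   induces the same topology as [enorm]. *)
Definition enorm (R : realType) (n : nat) (u : 'rV[R]_n) : R :=
  Num.sqrt (dotv u u).

Definition is_argmin (R : realType) (n : nat) (F : 'rV[R]_n -> R)
    (S : set 'rV[R]_n) (z : 'rV[R]_n) : Prop :=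
  S z /\ forall y, S y -> F z <= F y.

(* The default value [0] of [xget] is irrelevant when [S] is nonempty, closed
   and convex. *)
Definition proj (R : realType) (n : nat) (S : set 'rV[R]_n) (y : 'rV[R]_n) :
    'rV[R]_n :=
  xget 0 [set z | is_argmin (fun u => enorm (y - u)) S z].

(* [g] is a gradient at [x] of the function [F] whose domain is [S]: the values
   of [F] outside [S] play no role. When [x] is interior to [S] this is the usual
   differentiability, and [g] is unique; see [has_gradientTP]. *)
Definition has_gradient (R : realType) (n : nat) (S : set 'rV[R]_n)
    (F : 'rV[R]_n -> R) (x g : 'rV[R]_n) : Prop :=
  forall e : R, 0 < e ->
    \forall y \near within S (nbhs x),
      `|F y - F x - dotv g (y - x)| <= e * enorm (y - x).

Lemma dotv_is_linear (R : realType) (n : nat) (g : 'rV[R]_n) :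
  linear (dotv g : 'rV[R]_n -> R).
Proof.
move=> a u v; rewrite /dotv scaler_sumr -big_split /=; apply: eq_bigr => i _.
by rewrite !mxE mulrDr mulrCA.
Qed.

HB.instance Definition _ (R : realType) (n : nat) (g : 'rV[R]_n) :=
  GRing.isLinear.Build R 'rV[R]_n R _ (dotv g) (dotv_is_linear g).

Lemma dotv_continuous (R : realType) (n : nat) (g : 'rV[R]_n) :
  continuous (dotv g).
Proof.
move=> u; rewrite /continuous_at /dotv.
have := @cvg_big R 'I_n _ 0 xpredT (@add_continuous R) _ (nbhs u)
  (index_enum 'I_n) (fun i v => g 0 i * v 0 i) (fun i => g 0 i * u 0 i) _.
apply => i _.
by apply: cvgM; [exact: cvg_cst | exact: coord_continuous].
Qed.

Lemma ler_norm_enorm (R : realType) (n : nat) (u : 'rV[R]_n) :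
  `|u| <= enorm u.
Proof.
rewrite -[`|u|]/(mx_norm u).
have [->|/mx_norm_neq0[[i j] ->]] := eqVneq (mx_norm u) 0; first exact: sqrtr_ge0.
rewrite (ord1 i) -sqrtr_sqr; apply: ler_wsqrtr.
rewrite /dotv (bigD1 j) //= -expr2 lerDl.
by apply: sumr_ge0 => k _; rewrite -expr2 sqr_ge0.
Qed.

Lemma ler_enorm_norm (R : realType) (n : nat) (u : 'rV[R]_n) :
  enorm u <= n.+1%:R * `|u|.
Proof.
rewrite -[leRHS]ger0_norm ?mulr_ge0 // -sqrtr_sqr; apply: ler_wsqrtr.
have le_coord (i : 'I_n) : u 0 i * u 0 i <= `|u| ^+ 2.
  rewrite -expr2 -real_normK ?num_real // lerXn2r ?nnegrE //.
  rewrite -[`|u|]/(mx_norm u) mx_normrE.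
  exact: (le_bigmax _ (fun k => `|u k.1 k.2|) (0, i)).
apply: (le_trans (ler_sum _ (fun i _ => le_coord i))).
rewrite sumr_const card_ord -[leLHS]mulr_natl exprMn ler_pM ?sqr_ge0 //.
by rewrite -natrX ler_nat (leq_trans (leqnSn n)) // expnS leq_pmulr.
Qed.

Lemma has_gradientTP (R : realType) (n : nat) (S : set 'rV[R]_n)
    (F : 'rV[R]_n -> R) (x g : 'rV[R]_n) : S° x ->
  has_gradient S F x g <->
  differentiable F x /\ 'd F x = dotv g :> ('rV[R]_n -> R).
Proof.
move=> Sx.
have gradP : has_gradient S F x g <->
    F \o shift x = cst (F x) + dotv g +o_ (0 : 'rV[R]_n) id.
  rewrite eqaddoP; split=> [Fg e e0|Fg e e0].
    have e1 : 0 < e / n.+1%:R by rewrite divr_gt0.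
    have {}Fg : \forall y \near x,
        `|F y - F x - dotv g (y - x)| <= e / n.+1%:R * enorm (y - x).
      by apply: filterS2 Sx (Fg _ e1) => y Sy; exact.
    move: Fg; rewrite (near_shift 0 x) subr0.
    apply: filterS => y /=; rewrite addrK => Hy.
    rewrite -[(_ - _) y]/(F (y + x) - (F x + dotv g y)) opprD addrA.
    apply: (le_trans Hy).
    by rewrite -mulrA ler_pM2l // ler_pdivrMl // ler_enorm_norm.
  suff: \forall y \near x,
      `|F y - F x - dotv g (y - x)| <= e * enorm (y - x).
    by rewrite /within /=; apply: filterS.
  rewrite (near_shift 0 x) subr0.
  apply: filterS (Fg e e0) => y /=; rewrite addrK.
  rewrite -[(_ - _) y]/(F (y + x) - (F x + dotv g y)) opprD addrA => Hy.
  by apply: (le_trans Hy); rewrite ler_pM2l // ler_norm_enorm.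
rewrite gradP; split=> [Fg|[dF dFg]].
  have dFg := diff_unique (@dotv_continuous R n g) Fg.
  split=> //; apply/diff_locallyP; rewrite dFg; split=> //.
  exact: dotv_continuous.
by rewrite -dFg; exact: diff_locally.
Qed.

Definition pseudoconvex (R : realType) (n : nat) (S : set 'rV[R]_n)
    (F : 'rV[R]_n -> R) (gF : 'rV[R]_n -> 'rV[R]_n) : Prop :=
  forall x1 x2, S x1 -> S x2 -> 0 <= dotv (gF x1) (x2 - x1) -> F x1 <= F x2.

Definition strongly_convex_grad (R : realType) (n : nat) (S : set 'rV[R]_n)
    (gF : 'rV[R]_n -> 'rV[R]_n) (mu : R) : Prop :=
  forall x1 x2, S x1 -> S x2 ->
    mu * enorm (x1 - x2) ^+ 2 <= dotv (gF x1 - gF x2) (x1 - x2).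

Definition step_size_conditions (R : realType) (gamma beta : nat -> R)
    (mu_h L_h : R) : Prop :=
  (forall k, 0 < gamma k) /\ (forall k, 0 < beta k) /\
  (\sum_(0 <= k <oo) (gamma k)%:E = +oo)%E /\
  (\sum_(0 <= k <oo) (gamma k ^+ 2)%:E < +oo)%E /\
  (\sum_(0 <= k <oo) (beta k)%:E = +oo)%E /\
  (\sum_(0 <= k <oo) (beta k ^+ 2)%:E < +oo)%E /\
  (forall k, beta k <= beta 0%N) /\ beta 0%N <= 2 * mu_h / L_h ^+ 2 /\
  exists tau : R, 0 < tau < 1 /\
    (\sum_(0 <= k <oo) (gamma k `^ (2 - tau))%:E < +oo)%E /\
    (fun k => gamma k `^ tau / beta k) @ \oo --> (0 : R).

(* [xj k j], [xh k j] and [ti k i] stand for $x_k^j$, $x_k^{j+1/2}$ and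
   $\theta_k^i$; [gf x th] for $\nabla f(x,\theta)$; [nQ] and [nR] for $Q$ and
   $R$. *)
Definition multistep_scheme (R : realType) (n p : nat) (T : Type)
    (X : set 'rV[R]_n) (Theta : set 'rV[R]_p)
    (gf : 'rV[R]_n -> 'rV[R]_p -> 'rV[R]_n) (gh : 'rV[R]_p -> 'rV[R]_p)
    (gamma beta : nat -> R) (nQ nR : nat)
    (w : nat -> nat -> T -> 'rV[R]_p)
    (x : nat -> T -> 'rV[R]_n) (th : nat -> T -> 'rV[R]_p)
    (xj xh : nat -> nat -> T -> 'rV[R]_n)
    (ti : nat -> nat -> T -> 'rV[R]_p) : Prop :=
  forall (k : nat) (t : T),
    xj k 0%N t = x k t /\ ti k 0%N t = th k t /\
    (forall j, (j < nQ)%N ->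
      xh k j t = proj X (xj k j t - gamma k *: gf (xj k j t) (th k t)) /\
      xj k j.+1 t = proj X (xj k j t - gamma k *: gf (xh k j t) (th k t))) /\
    (forall i, (i < nR)%N ->
      ti k i.+1 t = proj Theta (ti k i t - beta k *: (gh (ti k i t) + w k i t)))
    /\
    x k.+1 t = xj k nQ t /\ th k.+1 t = ti k nR t.

Definition coords (R : realType) (n : nat) (T : Type) (v : T -> 'rV[R]_n) :
    set (T -> R) :=
  [set u | exists i : 'I_n, u = (fun t => v t 0 i)].

Definition random_vector (R : realType) (d : measure_display)
    (T : measurableType d) (n : nat) (v : T -> 'rV[R]_n) : Prop :=
  forall u, coords v u -> measurable_fun setT u.

Definition sigma_gen (R : realType) (T : Type) (U : set (T -> R)) :
    set (set T) :=
  <<s \bigcup_(u in U) preimage_set_system setT u measurable >>.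

(* The σ-algebra $\mathcal{M}_k^i$; [noise_history x th w ti k 0] is
   $\mathcal{F}_k$. *)
Definition noise_history (R : realType) (n p : nat) (T : Type)
    (x : nat -> T -> 'rV[R]_n) (th : nat -> T -> 'rV[R]_p)
    (w ti : nat -> nat -> T -> 'rV[R]_p) (k i : nat) : set (set T) :=
  sigma_gen
    (\bigcup_(l in [set l | (l <= k)%N]) (coords (x l) `|` coords (th l)) `|`
     \bigcup_(l in [set l | (l < i)%N])
        (coords (w k l) `|` coords (ti k l.+1))).

Local Open Scope ereal_scope.

(* [Z] is a version of $\mathbb{E}[Y \mid G]$. *)
Definition is_cond_exp (R : realType) (d : measure_display)
    (T : measurableType d) (P : probability T R) (G : set (set T))
    (Y Z : T -> R) : Prop :=
  P.-integrable setT (EFin \o Y) /\ P.-integrable setT (EFin \o Z) /\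
  (forall B : set R, measurable B -> G (Z @^-1` B)) /\
  (forall A, G A -> \int[P]_(t in A) (Z t)%:E = \int[P]_(t in A) (Y t)%:E).

Local Close Scope ereal_scope.

Definition noise_conditions (R : realType) (d : measure_display)
    (T : measurableType d) (P : probability T R) (n p : nat)
    (x : nat -> T -> 'rV[R]_n) (th : nat -> T -> 'rV[R]_p)
    (w ti : nat -> nat -> T -> 'rV[R]_p) (nR : nat) (nu : R) : Prop :=
  forall k i, (i < nR)%N ->
    random_vector (w k i) /\
    (forall j : 'I_p,
       is_cond_exp P (noise_history x th w ti k i)
         (fun t => w k i t 0 j) (fun=> 0)) /\
    (exists Z : T -> R,
       is_cond_exp P (noise_history x th w ti k i)
         (fun t => enorm (w k i t) ^+ 2) Z /\
       {ae P, forall t, Z t <= nu ^+ 2}).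

(* Main.v *)
Require Import Defs.
From HB Require Import structures.
From mathcomp Require Import all_boot all_order all_algebra.
From mathcomp Require Import all_classical all_reals all_analysis.
From mathcomp Require Import measurable_realfun ring lra.

Set Implicit Arguments.
Unset Strict Implicit.
Unset Printing Implicit Defensive.

Import Order.TTheory GRing.Theory Num.Theory.
Import numFieldNormedType.Exports.

Local Open Scope classical_set_scope.
Local Open Scope ring_scope.

(** The proof separates the two levels of the scheme; randomness is needed only
    for the learning level.

    Learning.  The minimiser [th_star] of [h] is a fixed point of the projected
    gradient map, which by strong convexity shrinks squared distances by the
    factor [1 - 2 * beta * mu_h + beta ^+ 2 * L_h ^+ 2].  The noise is orthogonal
    to everything its history determines, so the squared error
    [enorm (th k - th_star) ^+ 2] obeys in expectation a recursion with this
    factor and an additive term of order [beta k ^+ 2].  Summing the recursion,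
    [beta k * enorm (th k - th_star) ^+ 2] has a finite expected sum, and hence a
    finite sum almost surely ([learning_error_summable]).  The initial parameter
    may fail to be square integrable, so the argument is run on the events where
    it is bounded.

    Linking the time scales.  Since [gamma k `^ tau] is eventually below [beta k]
    and [gamma k `^ (2 - tau)] is summable, the inequality between the
    geometric and arithmetic means shows that [gamma k * enorm (th k - th_star)]
    is almost surely summable ([two_timescale_sum]).

    Optimisation.  What remains is deterministic ([extragradient_cvg]): an
    extragradient method for [f ^~ th_star] with gradient errors [eps k] such that
    [gamma k * eps k] is summable.  Pseudoconvexity gives the Minty inequality
    [0 <= dotv (gf y th_star) (y - z)] for every minimiser [z]
    ([pseudoconvex_minty]), so the squared distance to each minimiser is
    nonincreasing up to summable terms and converges ([robbins_siegmund]).  As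
    the [gamma k] are not summable, the Minty gap tends to [0] along a
    subsequence; by pseudoconvexity a cluster point of it is a minimiser, and
    convergence of the distance to that minimiser forces the whole sequence to
    converge to it.  First-order optimality of the limit is the claim. *)

(** * Euclidean geometry of row vectors *)

Section Euclidean.
Context {R : realType} {n : nat}.
Implicit Types (u v w : 'rV[R]_n) (S : set 'rV[R]_n).

Lemma dotvC u v : dotv u v = dotv v u.
Proof. by apply: eq_bigr => i _; rewrite mulrC. Qed.

Lemma dotvDr u v w : dotv u (v + w) = dotv u v + dotv u w.
Proof. exact: raddfD. Qed.

Lemma dotvNr u v : dotv u (- v) = - dotv u v.
Proof. exact: raddfN. Qed.

Lemma dotvZr a u v : dotv u (a *: v) = a * dotv u v.
Proof. exact: linearZ. Qed.

Lemma dotvDl u v w : dotv (v + w) u = dotv v u + dotv w u.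
Proof. by rewrite dotvC dotvDr ![dotv u _]dotvC. Qed.

Lemma dotvNl u v : dotv (- v) u = - dotv v u.
Proof. by rewrite dotvC dotvNr dotvC. Qed.

Lemma dotvZl a u v : dotv (a *: v) u = a * dotv v u.
Proof. by rewrite dotvC dotvZr dotvC. Qed.

Definition dotvE := (dotvDr, dotvDl, dotvNr, dotvNl, dotvZr, dotvZl).

Lemma dotvv_ge0 u : 0 <= dotv u u.
Proof. by apply: sumr_ge0 => i _; rewrite -expr2 sqr_ge0. Qed.

Lemma enorm_ge0 u : 0 <= enorm u.
Proof. exact: sqrtr_ge0. Qed.

Lemma enorm_sqr u : enorm u ^+ 2 = dotv u u.
Proof. exact/sqr_sqrtr/dotvv_ge0. Qed.

Lemma ler_coord_enorm u j : `|u 0 j| <= enorm u.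
Proof.
apply: le_trans (ler_norm_enorm _); rewrite -[leRHS]/(mx_norm _) mx_normrE.
exact: (le_bigmax 0 (fun k => `|u k.1 k.2|) (0, j)).
Qed.

Lemma enormN u : enorm (- u) = enorm u.
Proof. by rewrite /enorm !dotvE opprK. Qed.

Lemma enorm_distC u v : enorm (u - v) = enorm (v - u).
Proof. by rewrite -enormN opprB. Qed.

Lemma enorm0 : enorm (0 : 'rV[R]_n) = 0.
Proof. by rewrite /enorm raddf0 sqrtr0. Qed.

Lemma enormZ a u : enorm (a *: u) = `|a| * enorm u.
Proof. by rewrite /enorm !dotvE mulrA -expr2 sqrtrM ?sqr_ge0// sqrtr_sqr. Qed.

Lemma enorm_le0 u : enorm u <= 0 -> u = 0.
Proof.
move=> u0; apply/eqP; rewrite -normr_le0.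
exact: le_trans (ler_norm_enorm u) u0.
Qed.

(** Expand the square of [enorm v *: u - enorm u *: v]. *)
Lemma dotv_le_enorm u v : dotv u v <= enorm u * enorm v.
Proof.
have [u0|u0] := eqVneq (enorm u) 0.
  by rewrite (enorm_le0 (u := u)) ?u0// dotvC raddf0 enorm0 mul0r.
have [v0|v0] := eqVneq (enorm v) 0.
  by rewrite (enorm_le0 (u := v)) ?v0// raddf0 enorm0 mulr0.
have := dotvv_ge0 (enorm v *: u - enorm u *: v).
rewrite !dotvE (dotvC v u) -!enorm_sqr.
have up : 0 < enorm u by rewrite lt_neqAle eq_sym u0 enorm_ge0.
have vp : 0 < enorm v by rewrite lt_neqAle eq_sym v0 enorm_ge0.
move=> H; have : 0 <= 2 * (enorm u * enorm v) * (enorm u * enorm v - dotv u v).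
  by move: H; congr (0 <= _); ring.
by rewrite pmulr_rge0 ?subr_ge0// !mulr_gt0.
Qed.

Lemma ler_norm_dotv u v : `|dotv u v| <= enorm u * enorm v.
Proof.
by rewrite ler_norml dotv_le_enorm andbT lerNl -dotvNl -(enormN u) dotv_le_enorm.
Qed.

Lemma ler_enormD u v : enorm (u + v) <= enorm u + enorm v.
Proof.
rewrite -(@ler_pXn2r _ 2) ?nnegrE ?addr_ge0 ?enorm_ge0// sqrrD !enorm_sqr !dotvE.
rewrite (dotvC v u); have := dotv_le_enorm u v; lra.
Qed.

Lemma ler_enorm_dist u v w : enorm (u - w) <= enorm (u - v) + enorm (v - w).
Proof. by rewrite -(subrKA v u (- w)) ler_enormD. Qed.

Lemma enormD_sqr u v :
  enorm (u + v) ^+ 2 = enorm u ^+ 2 + 2 * dotv u v + enorm v ^+ 2.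
Proof. by rewrite !enorm_sqr !dotvE (dotvC v u); ring. Qed.

Lemma enormB_sqr u v :
  enorm (u - v) ^+ 2 = enorm u ^+ 2 - 2 * dotv u v + enorm v ^+ 2.
Proof. by rewrite enormD_sqr enormN dotvNr; ring. Qed.

Lemma enorm_continuous : continuous (@enorm R n).
Proof.
move=> u; apply/(@cvgrPdist_le R R _ (nbhs u)) => e e0.
have e1 : 0 < e / n.+1%:R by rewrite divr_gt0.
have : \forall v \near u, `|u - v| <= e / n.+1%:R.
  by apply/nbhs_ballP; exists (e / n.+1%:R) => // v; rewrite -ball_normE /= => /ltW.
apply: filterS => v uv.
have h : enorm (u - v) <= e.
  by apply: (le_trans (ler_enorm_norm _)); rewrite mulrC -ler_pdivlMr.
rewrite ler_norml; apply/andP; split.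
  by have := ler_enormD (v - u) u; rewrite subrK enorm_distC; lra.
by have := ler_enormD (u - v) v; rewrite subrK; lra.
Qed.

Lemma enorm_dist_continuous u : continuous (fun v => enorm (u - v)).
Proof.
move=> v; apply: (@continuous_comp _ _ _ (fun v => u - v)).
  by apply: continuousB; [exact: cst_continuous|exact: cvg_id].
exact: enorm_continuous.
Qed.

Lemma cvg_enorm (x_ : nat -> 'rV[R]_n) u :
  (forall e, 0 < e -> exists N, forall k, (N <= k)%N -> enorm (x_ k - u) <= e) ->
  x_ @ \oo --> u.
Proof.
move=> H; apply/cvgrPdist_le => e /H[N HN]; exists N => // k /= /HN.
by apply: le_trans; rewrite distrC; exact: ler_norm_enorm.
Qed.

Lemma convex_setP S : convex_set (S : set (convex_lmodType 'rV[R]_n)) ->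
  forall u v (t : R), S u -> S v -> 0 <= t <= 1 -> S (u + t *: (v - u)).
Proof.
move=> cS u v t Su Sv t01.
have [t0 t1] := andP t01.
have /set_mem := cS v u (Itv01 t0 t1) (mem_set Sv) (mem_set Su).
suff -> : u + t *: (v - u) = t *: v + (1 - t) *: u by [].
by rewrite scalerBr scalerBl scale1r addrCA.
Qed.
End Euclidean.

(** * Projection on a closed convex set *)

Section Projection.
Context {R : realType} {n : nat}.
Implicit Types (u v w : 'rV[R]_n) (S : set 'rV[R]_n).

(** Letting [t] tend to [0] in [c <= t * D]; this turns the inequalities
    obtained by moving a short way along a segment into first-order ones. *)
Lemma le0_of_le_scaled (c D : R) : 0 <= D ->
  (forall t, 0 < t <= 1 -> c <= t * D) -> c <= 0.
Proof.
move=> D0 H; rewrite leNgt; apply/negP => c0.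
have cD : 0 < 2 * c + D by lra.
have /H : 0 < c / (2 * c + D) <= 1.
  by rewrite divr_gt0//= ler_pdivrMr// mul1r; lra.
by rewrite mulrAC ler_pdivlMr// ler_pM2l//; lra.
Qed.

Lemma bounded_closed_enorm_compact S u (r : R) : closed S ->
  compact (S `&` [set v | enorm (u - v) <= r]).
Proof.
move=> clS; apply: bounded_closed_compact.
  exists (`|u| + r); split; first exact: num_real.
  move=> M rM v [_ /= uv]; apply: le_trans (ltW rM).
  rewrite -[v in `|v|](subKr u) (le_trans (ler_normB _ _))// lerD2l.
  exact: le_trans (ler_norm_enorm _) uv.
apply: closedI => //.
apply: (@preimage_closed _ _ (fun v => enorm (u - v)) [set s | s <= r]);
  last exact: closed_le.
by move=> v _; exact: enorm_dist_continuous.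
Qed.

Lemma argmin_dist_exists S y : S !=set0 -> closed S ->
  exists z, is_argmin (fun u => enorm (y - u)) S z.
Proof.
move=> [s Ss] clS.
pose A := S `&` [set v | enorm (y - v) <= enorm (y - s)].
have A0 : A !=set0 by exists s; split => /=.
have cA : compact A by exact: bounded_closed_enorm_compact.
have cF : {within A, continuous (fun u => enorm (y - u))}.
  by apply: continuous_subspaceT => v; exact: enorm_dist_continuous.
have [z /set_mem[Sz zs] zmin] := EVT_min_rV A0 cA cF.
exists z; split=> // u Su.
have [us|us] := leP (enorm (y - u)) (enorm (y - s)).
  by apply: zmin; rewrite inE.
exact: le_trans zs (ltW us).
Qed.

Context (S : set 'rV[R]_n) (S0 : S !=set0) (clS : closed S).
Context (cS : convex_set (S : set (convex_lmodType 'rV[R]_n))).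

Lemma proj_argmin y : is_argmin (fun u => enorm (y - u)) S (Defs.proj S y).
Proof. by rewrite /Defs.proj; apply: xgetPex; exact: argmin_dist_exists. Qed.

Lemma proj_in y : S (Defs.proj S y).
Proof. by case: (proj_argmin y). Qed.

(** Moving from the projection towards [z] stays in [S] and so cannot decrease the
    distance to [y]; the first-order part of the change of its square is
    proportional to the scalar product. *)
Lemma proj_obtuse y z : S z -> dotv (y - Defs.proj S y) (z - Defs.proj S y) <= 0.
Proof.
move=> Sz; have [Sp pmin] := proj_argmin y.
set p := Defs.proj S y in Sp pmin *.
suff : 2 * dotv (y - p) (z - p) <= 0 by lra.
apply: (le0_of_le_scaled (sqr_ge0 (enorm (z - p)))) => t /andP[t0 t1].
have := pmin _ (convex_setP cS Sp Sz (t := t) _).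
rewrite (ltW t0) t1 => /(_ isT).
rewrite -(@ler_pXn2r _ 2) ?nnegrE ?enorm_ge0// opprD addrA (enormB_sqr (y - p)).
rewrite dotvZr enormZ exprMn -normrX ger0_norm ?sqr_ge0// => H.
rewrite -(ler_pM2l t0); move: H; lra.
Qed.

Lemma proj_id z : S z -> Defs.proj S z = z.
Proof.
move=> Sz; apply/eqP; rewrite eq_sym -subr_eq0; apply/eqP/enorm_le0.
by have [_ /(_ _ Sz)] := proj_argmin z; rewrite subrr enorm0.
Qed.

(** Add the two obtuse-angle inequalities at the projections and apply
    Cauchy-Schwarz. *)
Lemma proj_nonexpansive y1 y2 :
  enorm (Defs.proj S y1 - Defs.proj S y2) <= enorm (y1 - y2).
Proof.
have := proj_obtuse y1 (proj_in y2); have := proj_obtuse y2 (proj_in y1).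
set p1 := Defs.proj S y1; set p2 := Defs.proj S y2 => H2 H1.
have H : enorm (p1 - p2) ^+ 2 <= enorm (y1 - y2) * enorm (p1 - p2).
  apply: le_trans (dotv_le_enorm _ _); rewrite enorm_sqr.
  by move: H1 H2; rewrite !dotvE (dotvC p2 p1); lra.
have [p0|p0] := leP (enorm (p1 - p2)) 0.
  exact: le_trans p0 (enorm_ge0 _).
by move: H; rewrite expr2 ler_pM2r.
Qed.

End Projection.

(** * First-order conditions and pseudoconvexity *)

Section FirstOrder.
Context {R : realType} {n : nat}.
Context (S : set 'rV[R]_n).
Context (cS : convex_set (S : set (convex_lmodType 'rV[R]_n))).
Context (F : 'rV[R]_n -> R).

(** The form in which gradients on [S] are used: a step of some positive length
    towards any point of [S] at which the linear approximation is good. *)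
Lemma has_gradient_segment x y g e : S x -> S y -> has_gradient S F x g ->
  0 < e -> exists2 t : R, 0 < t <= 1 &
    `|F (x + t *: (y - x)) - F x - t * dotv g (y - x)| <= t * e.
Proof.
move=> Sx Sy Fg e0.
have [/enorm_le0/eqP|D0] := leP (enorm (y - x)) 0.
  rewrite subr_eq0 => /eqP ->; exists 1; first by rewrite ltr01 lexx.
  by rewrite subrr scaler0 addr0 raddf0 mulr0 subr0 subrr normr0 mul1r ltW.
have /nbhs_ballP[d /= d0 Hd] := Fg _ (divr_gt0 e0 D0).
(* This [t] keeps the step within distance [d] of [x]. *)
pose t := Num.min 1 (d / (2 * enorm (y - x))).
have t0 : 0 < t by rewrite lt_min ltr01 divr_gt0// mulr_gt0.
have t1 : t <= 1 by rewrite ge_min lexx.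
exists t; first by rewrite t0.
have := Hd (x + t *: (y - x)).
have -> : x + t *: (y - x) - x = t *: (y - x) by rewrite addrAC subrr add0r.
rewrite dotvZr enormZ (gtr0_norm t0) mulrCA divfK ?gt_eqF//; apply.
  rewrite -ball_normE /= opprD addNKr normrN.
  apply: le_lt_trans (ler_norm_enorm _) _; rewrite enormZ gtr0_norm//.
  have : t <= d / (2 * enorm (y - x)) by rewrite ge_min lexx orbT.
  by rewrite ler_pdivlMr ?mulr_gt0//; lra.
by apply: convex_setP => //; rewrite (ltW t0).
Qed.

Lemma has_gradient_ascent x y g : S x -> S y -> has_gradient S F x g ->
  0 < dotv g (y - x) ->
  exists2 t : R, 0 < t <= 1 & F x < F (x + t *: (y - x)).
Proof.
move=> Sx Sy Fg g0.
have e0 : 0 < dotv g (y - x) / 2 by rewrite divr_gt0.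
have [t /andP[t0 t1]] := has_gradient_segment Sx Sy Fg e0.
rewrite ler_norml => /andP[H _]; exists t; first by rewrite t0.
have : 0 < t * dotv g (y - x) by rewrite mulr_gt0.
by move: H; lra.
Qed.

Lemma argmin_first_order z g : is_argmin F S z -> has_gradient S F z g ->
  forall y, S y -> 0 <= dotv g (y - z).
Proof.
move=> [Sz zmin] Fg y Sy; rewrite leNgt; apply/negP => g0.
have e0 : 0 < - dotv g (y - z) / 2 by rewrite divr_gt0// oppr_gt0.
have [t /andP[t0 t1]] := has_gradient_segment Sz Sy Fg e0.
rewrite ler_norml => /andP[_ H].
have : t * dotv g (y - z) < 0 by rewrite pmulr_rlt0.
have : F z <= F (z + t *: (y - z)).
  by apply: zmin; apply: convex_setP => //; rewrite (ltW t0).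
by move: H; lra.
Qed.

Lemma has_gradient_continuous x g : has_gradient S F x g ->
  F @ within S (nbhs x) --> F x.
Proof.
move=> Fg; apply/cvgrPdist_le => e e0.
have C0 : 0 < (1 + enorm g) * n.+1%:R.
  by rewrite mulr_gt0// ltr_wpDr// enorm_ge0.
have H : \forall y \near x, enorm (y - x) <= e / (1 + enorm g).
  apply/nbhs_ballP; exists (e / ((1 + enorm g) * n.+1%:R)) => /=.
    by rewrite divr_gt0.
  move=> y; rewrite -ball_normE /= distrC => /ltW xy.
  apply: le_trans (ler_enorm_norm _) _.
  by rewrite mulrC -ler_pdivlMr// -mulrA -invfM.
have Fg1 : \forall y \near x, S y ->
    `|F y - F x - dotv g (y - x)| <= 1 * enorm (y - x) := Fg _ ltr01.
rewrite near_withinE; apply: filterS2 H Fg1 => y yx /[swap] Sy /(_ Sy) H.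
have g1 : 0 < 1 + enorm g by rewrite ltr_wpDr// enorm_ge0.
move: yx; rewrite ler_pdivlMr// => yx.
have := ler_norm_dotv g (y - x); move: H.
rewrite distrC !ler_norml => /andP[H1 H2] /andP[H3 H4].
by apply/andP; split; lra.
Qed.

(** If [<gF y, z - y> > 0] at some [y], pseudoconvexity gives [F y = F z], so
    [F] first rises and then returns to its minimal value on the segment from
    [y] to [z].  At a maximiser [p] of [F] on that segment the slope towards [z]
    is nonnegative because the slope towards [y] is nonpositive; pseudoconvexity
    at [p] then bounds the maximum by [F z], a contradiction. *)
Lemma pseudoconvex_minty (gF : 'rV[R]_n -> 'rV[R]_n) z :
  (forall x, S x -> has_gradient S F x (gF x)) -> pseudoconvex S F gF ->
  is_argmin F S z -> forall y, S y -> 0 <= dotv (gF y) (y - z).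
Proof.
move=> Fg pc [Sz zmin] y Sy; rewrite leNgt; apply/negP => H.
have {}H : 0 < dotv (gF y) (z - y) by rewrite -opprB dotvNr oppr_gt0.
have Fyz : F y = F z.
  by apply: le_anti; rewrite (pc _ _ Sy Sz (ltW H)) zmin.
pose seg (t : R) := y + t *: (z - y).
have Sseg t : 0 <= t <= 1 -> S (seg t) by exact: convex_setP.
have cA : compact (seg @` `[0, 1]).
  apply: continuous_compact; last exact: segment_compact.
  apply: continuous_subspaceT => t.
  apply: (@cvgD _ _ _ _ _ (cst y) (fun t => t *: (z - y))); first exact: cvg_cst.
  exact: scalel_continuous.
have AS : seg @` `[0, 1] `<=` S by move=> _ [t /= t01 <-]; apply: Sseg; rewrite in_itv/= in t01.
have cF : {within seg @` `[0, 1], continuous F}.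
  apply: continuous_subspaceW AS _; apply/subspace_continuousP => x Sx.
  exact: has_gradient_continuous (Fg _ Sx).
have A0 : seg @` `[0, 1] !=set0.
  by exists (seg 0), 0 => //=; rewrite in_itv/= lexx ler01.
have [p /set_mem[c /= + cp] pmax] := EVT_max_rV A0 cA cF.
rewrite in_itv/= => /andP[c0 c1].
have [t /andP[t0 t1] Ft] := has_gradient_ascent Sy Sz (Fg _ Sy) H.
have Fp : F z < F p.
  rewrite -Fyz; apply: lt_le_trans Ft _; apply: pmax; rewrite inE.
  by exists t => //=; rewrite in_itv/= (ltW t0).
(* The maximum is not attained at the end [y]. *)
have {}c0 : 0 < c.
  rewrite lt_neqAle c0 andbT; apply/eqP => c0'; move: Fp.
  by rewrite -cp -c0' /seg scale0r addr0 Fyz ltxx.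
have Sp : S p by rewrite -cp; apply: Sseg; rewrite (ltW c0).
have gy : dotv (gF p) (y - p) <= 0.
  rewrite leNgt; apply/negP => /(has_gradient_ascent Sp Sy (Fg _ Sp))[s /andP[s0 s1]].
  rewrite ltNge; apply/negP; rewrite negbK; apply: pmax; rewrite inE.
  exists (c - s * c) => /=; last first.
    by rewrite -cp /seg opprD addNKr scalerN scalerA scalerBl addrA.
  have sc : s * c <= 1 * c by rewrite ler_pM2r.
  have : 0 < s * c by rewrite mulr_gt0.
  by rewrite in_itv/=; lra.
have gz : 0 <= dotv (gF p) (z - p).
  have -> : z - p = (1 - c) *: (z - y).
    by rewrite -cp /seg scalerBl scale1r opprD addrA.
  move: gy; rewrite -[in y - p]cp /seg opprD addNKr dotvNr dotvZr oppr_le0 pmulr_rge0// => gy.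
  by rewrite dotvZr mulr_ge0// subr_ge0.
by have := lt_le_trans Fp (pc _ _ Sp Sz gz); rewrite ltxx.
Qed.

End FirstOrder.

(** * Summable perturbations *)

Section Sums.
Context {R : realType}.
Implicit Types u v g a : nat -> R.

(** Summability of a nonnegative sequence, without extended reals. *)
Definition bounded_sums u := exists M, forall N, \sum_(0 <= k < N) u k <= M.

Lemma bounded_sums_lty u : (forall k, 0 <= u k) ->
  (\sum_(0 <= k <oo) (u k)%:E < +oo)%E -> bounded_sums u.
Proof.
move=> u0 uoo; exists (fine (\sum_(0 <= k <oo) (u k)%:E)%E) => N.
rewrite -lee_fin fineK; last first.
  by rewrite ge0_fin_numE// nneseries_ge0// => k _; rewrite lee_fin.
rewrite -sumEFin; apply: nneseries_lim_ge => k _ _.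
by rewrite lee_fin.
Qed.

Lemma unbounded_sums_eqy u : (forall k, 0 <= u k) ->
  (\sum_(0 <= k <oo) (u k)%:E = +oo)%E -> ~ bounded_sums u.
Proof.
move=> u0 uoo [M HM].
have : (\sum_(0 <= k <oo) (u k)%:E <= M%:E)%E.
  apply: lime_le; first by apply: is_cvg_nneseries => k _ _; rewrite lee_fin.
  by apply: nearW => N; rewrite sumEFin lee_fin.
by rewrite uoo leNgt ltry.
Qed.

Lemma bounded_sums_nneseries u : (forall k, 0 <= u k) ->
  bounded_sums u -> (\sum_(0 <= k <oo) (u k)%:E < +oo)%E.
Proof.
move=> u0 [M HM]; apply: (@le_lt_trans _ _ M%:E); last exact: ltry.
apply: lime_le; first by apply: is_cvg_nneseries => k _ _; rewrite lee_fin.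
by apply: nearW => N; rewrite sumEFin lee_fin.
Qed.

Lemma bounded_sumsD u v : bounded_sums u -> bounded_sums v ->
  bounded_sums (fun k => u k + v k).
Proof.
by move=> [M HM] [M' HM']; exists (M + M') => N; rewrite big_split lerD.
Qed.

Lemma bounded_sumsZ c u : 0 <= c -> bounded_sums u ->
  bounded_sums (fun k => c * u k).
Proof. by move=> c0 [M HM]; exists (c * M) => N; rewrite -mulr_sumr ler_wpM2l. Qed.

Lemma bounded_sums_le_near u v N0 : (forall k, 0 <= v k) ->
  bounded_sums v -> (forall k, (N0 <= k)%N -> u k <= v k) -> bounded_sums u.
Proof.
move=> v0 [M HM] uv; exists (\sum_(0 <= k < N0) `|u k| + M) => N.
have u1 N1 : \sum_(0 <= k < N1) u k <= \sum_(0 <= k < N1) `|u k|.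
  by apply: ler_sum => k _; exact: ler_norm.
have M0 : 0 <= M by have := HM 0%N; rewrite big_nil.
case: (leqP N N0) => [NN0|/ltnW NN0].
  apply: le_trans (u1 N) _; rewrite (big_cat_nat (leq0n _) NN0)//= -addrA lerDl.
  by rewrite addr_ge0// sumr_ge0.
rewrite (big_cat_nat (leq0n _) NN0)//= lerD//.
apply: (@le_trans _ _ (\sum_(N0 <= k < N) v k)).
  by apply: ler_sum_nat => k /andP[/uv].
by apply: le_trans (HM N); rewrite [leRHS](big_cat_nat (leq0n _) NN0)//= lerDr sumr_ge0.
Qed.

Lemma bounded_sums_le u v : bounded_sums v -> (forall k, u k <= v k) ->
  bounded_sums u.
Proof.
move=> [M HM] uv; exists M => N; apply: le_trans (HM N).
exact: ler_sum.
Qed.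

Lemma bounded_sums_cvg u : (forall k, 0 <= u k) -> bounded_sums u ->
  cvgn (fun N => \sum_(0 <= k < N) u k).
Proof.
move=> u0 [M HM]; apply: nondecreasing_is_cvgn.
  by apply/nondecreasing_seqP => N; rewrite big_nat_recr//= lerDl.
by exists M => _ [N _ <-].
Qed.

Lemma bounded_sums_to0 u : (forall k, 0 <= u k) -> bounded_sums u ->
  forall e, 0 < e -> exists N, forall k, (N <= k)%N -> u k <= e.
Proof.
move=> u0 /(bounded_sums_cvg u0) /cvg_series_cvg_0 /cvgrPdist_le H e /H[N _ HN].
by exists N => k /HN; rewrite sub0r normrN ger0_norm.
Qed.

Lemma bounded_sums_sqr u : (forall k, 0 <= u k) -> bounded_sums u ->
  bounded_sums (fun k => u k ^+ 2).
Proof.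
move=> u0 bu; have [N HN] := bounded_sums_to0 u0 bu ltr01.
apply: (bounded_sums_le_near u0 bu) => k /HN uk.
by rewrite expr2 ler_piMr.
Qed.

(** The deterministic form of the Robbins-Siegmund lemma.  With [S k] and [V k]
    the partial sums of [u] and [v], the sequence [a k * expR (- S k) - V k] is
    nonincreasing and bounded below, and it decreases by at least a constant
    multiple of [g k]. *)
Lemma robbins_siegmund a u v g :
  (forall k, 0 <= a k) -> (forall k, 0 <= u k) -> (forall k, 0 <= v k) ->
  (forall k, 0 <= g k) -> bounded_sums u -> bounded_sums v ->
  (forall k, a k.+1 <= expR (u k) * (a k + v k) - g k) ->
  bounded_sums g /\ exists l : R, a @ \oo --> l.
Proof.
move=> a0 u0 v0 g0 bu bv rec.
pose S N := \sum_(0 <= k < N) u k; pose V N := \sum_(0 <= k < N) v k.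
have S0 N : 0 <= S N by exact: sumr_ge0.
pose d k := a k * expR (- S k) - V k.
have [MU HU] := bu; have [MV HV] := bv.
have dS k : d k.+1 <= d k - g k * expR (- MU).
  have SS : S k.+1 = S k + u k by rewrite /S big_nat_recr.
  have VS : V k.+1 = V k + v k by rewrite /V big_nat_recr.
  have h1 : a k.+1 * expR (- S k.+1) <=
      (expR (u k) * (a k + v k) - g k) * expR (- S k.+1).
    by rewrite ler_wpM2r ?expR_ge0.
  have h2 : (expR (u k) * (a k + v k) - g k) * expR (- S k.+1) =
      a k * expR (- S k) + v k * expR (- S k) - g k * expR (- S k.+1).
    rewrite mulrBl; congr (_ - _).
    rewrite SS opprD expRD expRN; have := expR_gt0 (u k).
    by rewrite expRN => ?; field; rewrite !gt_eqF// expR_gt0.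
  have h3 : v k * expR (- S k) <= v k.
    by rewrite ler_piMr// -[leRHS]expR0 ler_expR oppr_le0.
  have h4 : g k * expR (- MU) <= g k * expR (- S k.+1).
    by rewrite ler_wpM2l// ler_expR lerN2 HU.
  by rewrite /d VS; move: h1; rewrite h2; lra.
have dlb k : - MV <= d k.
  have : 0 <= a k * expR (- S k) by rewrite mulr_ge0 ?expR_ge0.
  by have := HV k; rewrite -/(V k) /d; lra.
have sumg N : expR (- MU) * \sum_(0 <= k < N) g k <= d 0%N - d N.
  elim: N => [|N IH]; first by rewrite big_nil mulr0 subrr.
  by rewrite big_nat_recr//= mulrDr; have := dS N; lra.
split.
  exists (expR MU * (d 0%N + MV)) => N.
  rewrite -ler_pdivrMl ?expR_gt0// -expRN.
  by have := sumg N; have := dlb N; lra.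
have cd : cvgn d.
  apply: nonincreasing_is_cvgn.
    apply/nonincreasing_seqP => k; apply: le_trans (dS k) _.
    by rewrite gerBl mulr_ge0 ?expR_ge0.
  by exists (- MV) => _ [N _ <-].
have cS : cvgn S by exact: bounded_sums_cvg.
have cV : cvgn V by exact: bounded_sums_cvg.
exists ((lim (d @ \oo) + lim (V @ \oo)) * expR (lim (S @ \oo))).
have -> : a = (fun k => (d k + V k) * expR (S k)).
  apply/funext => k; rewrite /d subrK -mulrA -expRD addNr expR0 mulr1//.
apply: cvgM; first exact: cvgD.
by apply: continuous_cvg => //; exact: continuous_expR.
Qed.

(** Compounding [Q.+1] inner steps into one step of the kind handled by
    [robbins_siegmund]; only the decrease [g] of the first inner step is kept. *)
Lemma iterated_growth (b : nat -> R) (u v g : R) Q : 0 <= u -> 0 <= v -> 0 <= g ->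
  b 1%N <= expR u * (b 0%N + v) - g ->
  (forall j, (j < Q.+1)%N -> b j.+1 <= expR u * (b j + v)) ->
  b Q.+1 <= expR (Q.+1%:R * u) * (b 0%N + Q.+1%:R * v) - g.
Proof.
move=> u0 v0 g0 b1; elim: Q => [|Q IH] H; first by rewrite !mul1r.
have {}IH := IH (fun j jQ => H j (ltnW jQ)).
apply: le_trans (H _ (ltnSn _)) _.
have eu : 1 <= expR u by rewrite -expR0 ler_expR.
have eQ : 1 <= expR (Q.+1%:R * u) by rewrite -expR0 ler_expR mulr_ge0.
have -> : expR (Q.+2%:R * u) = expR u * expR (Q.+1%:R * u).
  by rewrite -expRD; congr expR; rewrite -[in LHS]natr1; ring.
have -> : Q.+2%:R * v = Q.+1%:R * v + v by rewrite -natr1; ring.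
apply: (@le_trans _ _ (expR u *
    (expR (Q.+1%:R * u) * (b 0%N + Q.+1%:R * v) - g + v))).
  by rewrite ler_pM2l ?expR_gt0// lerD2r.
have : v <= expR (Q.+1%:R * u) * v by rewrite ler_peMl.
have : g <= expR u * g by rewrite ler_peMl.
rewrite -(ler_pM2l (expR_gt0 u)) => h1; rewrite -(ler_pM2l (expR_gt0 u)) => h2.
move: h1 h2; rewrite ler_pM2l ?expR_gt0// => h1 h2.
by lra.
Qed.

End Sums.

(** * Convergence of the inexact extragradient method *)

Section ExtragradientStep.
Context {R : realType} {n : nat} (X : set 'rV[R]_n).
Context (X0 : X !=set0) (clX : closed X).
Context (cX : convex_set (X : set (convex_lmodType 'rV[R]_n))).
Implicit Types x y z u : 'rV[R]_n.

(** One extragradient step with an inexact gradient [G].  Since gradients are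
    bounded, the midpoint [y] is within [gam * (B + eps)] of [x], so everything
    that distinguishes the step from a gradient step taken at [y] is of second
    order in [gam].  Hence nonexpansiveness of the projection suffices.  The inexactness costs [2 * gam * eps * enorm (x - z)], which
    [2 * D <= 1 + D ^+ 2] splits into a growth factor and an error. *)
Lemma extragradient_step (g G : 'rV[R]_n -> 'rV[R]_n) (B eps gam : R) x y xp z :
  0 <= eps -> 0 <= gam ->
  (forall u, X u -> enorm (g u) <= B) ->
  (forall u, X u -> enorm (G u - g u) <= eps) ->
  X x -> X z -> y = Defs.proj X (x - gam *: G x) ->
  xp = Defs.proj X (x - gam *: G y) ->
  enorm (x - y) <= gam * (B + eps) /\
  enorm (xp - z) ^+ 2 <= expR (gam * eps) *
    (enorm (x - z) ^+ 2 + (gam * eps + 5 * (gam * B + gam * eps) ^+ 2))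
    - 2 * gam * dotv (g y) (y - z).
Proof.
move=> eps0 gam0 gB Gg Xx Xz yE xpE.
have Xy : X y by rewrite yE; exact: proj_in.
have GB u : X u -> enorm (G u) <= B + eps.
  move=> Xu; rewrite -(subrK (g u) (G u)) [leRHS]addrC.
  by rewrite (le_trans (ler_enormD _ _))// lerD ?gB ?Gg.
have xy : enorm (x - y) <= gam * (B + eps).
  rewrite -[in enorm (x - y)](proj_id X0 clX Xx) yE.
  apply: le_trans (proj_nonexpansive X0 clX cX _ _) _.
  by rewrite subKr enormZ ger0_norm// ler_wpM2l// GB.
split=> //.
set C := B + eps in xy *.
have C0 : 0 <= C by apply: le_trans (GB _ Xx); exact: enorm_ge0.
set D := enorm (x - z).
have yz : enorm (y - z) <= gam * C + D.
  by apply: le_trans (ler_enorm_dist _ x _) _; rewrite lerD2r enorm_distC.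
have h1 : enorm (xp - z) ^+ 2 <= enorm (x - z - gam *: G y) ^+ 2.
  rewrite ler_pXn2r ?nnegrE ?enorm_ge0//.
  rewrite -[in leLHS](proj_id X0 clX Xz) xpE addrAC.
  exact: proj_nonexpansive.
rewrite (enormB_sqr (x - z)) dotvZr enormZ exprMn (ger0_norm gam0) -/D in h1.
have h2 : dotv (x - z) (G y) = dotv (g y) (y - z) + dotv (G y) (x - y)
    + dotv (G y - g y) (y - z).
  by rewrite !dotvE (dotvC x) (dotvC z); ring.
have h3 : - dotv (G y) (x - y) <= C * (gam * C).
  rewrite -dotvNr; apply: le_trans (dotv_le_enorm _ _) _.
  by rewrite enormN ler_pM ?enorm_ge0// GB.
have h4 : - dotv (G y - g y) (y - z) <= eps * (gam * C + D).
  rewrite -dotvNr; apply: le_trans (dotv_le_enorm _ _) _.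
  by rewrite enormN ler_pM ?enorm_ge0// Gg.
have h5 : enorm (G y) ^+ 2 <= C ^+ 2.
  by rewrite ler_pXn2r ?nnegrE ?enorm_ge0// GB.
have D0 : 0 <= D by exact: enorm_ge0.
rewrite -mulrDr -/C.
have epsC : eps <= C.
  by rewrite lerDr; apply: le_trans (gB _ Xx); exact: enorm_ge0.
have k3 : gam * (- dotv (G y) (x - y)) <= gam * (C * (gam * C)) by rewrite ler_wpM2l.
have k4 : gam * (- dotv (G y - g y) (y - z)) <= gam * (eps * (gam * C + D)).
  by rewrite ler_wpM2l.
have k5 : gam ^+ 2 * enorm (G y) ^+ 2 <= gam ^+ 2 * C ^+ 2.
  by rewrite ler_wpM2l// sqr_ge0.
have k6 : gam ^+ 2 * (eps * C) <= gam ^+ 2 * (C * C).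
  by rewrite ler_wpM2l ?sqr_ge0// ler_wpM2r.
have k7 : gam * eps * (2 * D) <= gam * eps * (1 + D ^+ 2).
  by rewrite ler_wpM2l ?mulr_ge0//; have := sqr_ge0 (D - 1); lra.
apply: (@le_trans _ _ ((1 + gam * eps) * (D ^+ 2 + (gam * eps + 5 * (gam * C) ^+ 2))
    - 2 * gam * dotv (g y) (y - z))); last first.
  rewrite lerD2r ler_wpM2r ?expR_ge1Dx//.
  by rewrite !addr_ge0 ?mulr_ge0 ?sqr_ge0.
have k8 : 0 <= gam * eps * (gam * eps + 5 * (gam * C) ^+ 2).
  by rewrite mulr_ge0 ?addr_ge0 ?mulr_ge0 ?sqr_ge0.
move: h1 k3 k4 k5 k6 k7 k8; rewrite h2.
have -> : gam * (C * (gam * C)) = gam ^+ 2 * (C * C) by ring.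
lra.
Qed.

Lemma bounded_cluster_point (u : nat -> 'rV[R]_n) z r :
  (forall m, X (u m)) -> (forall m, enorm (z - u m) <= r) ->
  exists2 xbar, X xbar & forall e N, 0 < e ->
    exists2 m, (N <= m)%N & enorm (u m - xbar) <= e.
Proof.
move=> Xu ur.
have cA : compact (X `&` [set v | enorm (z - v) <= r]).
  exact: bounded_closed_enorm_compact.
have [|xbar [[Xb _] clb]] := cA (u @ \oo) _.
  by exists 0%N => // m _; split; [exact: Xu|exact: ur].
exists xbar => // e N e0.
have nb : nbhs xbar (ball xbar (e / n.+1%:R)).
  by apply/nbhs_ballP; exists (e / n.+1%:R) => //=; rewrite divr_gt0.
have fu : (u @ \oo) (u @` [set m | (N <= m)%N]).
  by exists N => // m /= Nm; exists m.
have [_ [[m /= Nm <-] mb]] := clb _ _ fu nb.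
exists m => //; rewrite enorm_distC; apply: le_trans (ler_enorm_norm _) _.
by rewrite mulrC -ler_pdivlMr//; move: mb; rewrite -ball_normE => /ltW.
Qed.

End ExtragradientStep.

Section Extragradient.
Context {R : realType} {n : nat} (X : set 'rV[R]_n).
Context (X0 : X !=set0) (clX : closed X).
Context (cX : convex_set (X : set (convex_lmodType 'rV[R]_n))).
Context (F : 'rV[R]_n -> R) (g : 'rV[R]_n -> 'rV[R]_n) (L B : R).
Context (F_grad : forall x, X x -> has_gradient X F x (g x)).
Context (F_pseudo : pseudoconvex X F g).
Context (g_lip : forall x1 x2, X x1 -> X x2 ->
  enorm (g x1 - g x2) <= L * enorm (x1 - x2)).
Context (g_bnd : forall x, X x -> enorm (g x) <= B).
Context (F_min : exists z, is_argmin F X z).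
Context (G : nat -> 'rV[R]_n -> 'rV[R]_n) (eps gam : nat -> R).
Context (eps_ge0 : forall k, 0 <= eps k) (gam_gt0 : forall k, 0 < gam k).
Context (G_eps : forall k u, X u -> enorm (G k u - g u) <= eps k).
Context (gam_sum : ~ bounded_sums gam).
Context (gam2_sum : bounded_sums (fun k => gam k ^+ 2)).
Context (gam_eps_sum : bounded_sums (fun k => gam k * eps k)).
Context (Q : nat) (x : nat -> 'rV[R]_n) (xj xh : nat -> nat -> 'rV[R]_n).
Context (x_in : X (x 0%N)) (xj0 : forall k, xj k 0%N = x k).
Context (xhE : forall k j, (j < Q.+1)%N ->
  xh k j = Defs.proj X (xj k j - gam k *: G k (xj k j))).
Context (xjE : forall k j, (j < Q.+1)%N ->
  xj k j.+1 = Defs.proj X (xj k j - gam k *: G k (xh k j))).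
Context (xE : forall k, x k.+1 = xj k Q.+1).

Let gam_ge0 k : 0 <= gam k. Proof. exact: ltW. Qed.

Let gam_eps_ge0 k : 0 <= gam k * eps k. Proof. by rewrite mulr_ge0. Qed.

Let x_in_all k : X (x k).
Proof. by case: k => // k; rewrite xE xjE//; exact: proj_in. Qed.

Let xj_in k j : (j <= Q)%N -> X (xj k j).
Proof.
case: j => [_|j jQ]; first by rewrite xj0.
by rewrite (xjE k (leqW jQ)); exact: proj_in.
Qed.

Let xh_in k j : (j < Q.+1)%N -> X (xh k j).
Proof. by move=> jQ; rewrite xhE//; exact: proj_in. Qed.

Let v k := gam k * eps k + 5 * (gam k * B + gam k * eps k) ^+ 2.

Let v_ge0 k : 0 <= v k.
Proof. by rewrite addr_ge0// mulr_ge0// sqr_ge0. Qed.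

Let v_sum : bounded_sums v.
Proof.
have b2 := bounded_sums_sqr gam_eps_ge0 gam_eps_sum.
have B2 : 0 <= 2 * B ^+ 2 by rewrite mulr_ge0// sqr_ge0.
have bv : bounded_sums (fun k => (gam k * B + gam k * eps k) ^+ 2).
  apply: (bounded_sums_le (bounded_sumsD (bounded_sumsZ B2 gam2_sum)
    (bounded_sumsZ (ler0n R 2) b2))) => k.
  by have := sqr_ge0 (gam k * B - gam k * eps k); lra.
exact: (bounded_sumsD gam_eps_sum (bounded_sumsZ (ler0n R 5) bv)).
Qed.

Let gap z k := dotv (g (xh k 0%N)) (xh k 0%N - z).

(** By [pseudoconvex_minty] the gap is nonnegative, so the squared distance to
    any minimiser decreases up to summable perturbations. *)
Let quasi_fejer z : is_argmin F X z ->
  bounded_sums (fun k => 2 * gam k * gap z k) /\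
  exists l : R, (fun k => enorm (x k - z) ^+ 2) @ \oo --> l.
Proof.
move=> zmin; have Xz : X z by case: zmin.
have gap_ge0 k j : (j < Q.+1)%N -> 0 <= 2 * gam k * dotv (g (xh k j)) (xh k j - z).
  move=> jQ; rewrite !mulr_ge0//.
  by apply: (pseudoconvex_minty cX F_grad F_pseudo zmin); exact: xh_in.
have step k j : (j < Q.+1)%N -> enorm (xj k j.+1 - z) ^+ 2 <=
    expR (gam k * eps k) * (enorm (xj k j - z) ^+ 2 + v k)
    - 2 * gam k * dotv (g (xh k j)) (xh k j - z).
  move=> jQ; have [_] := extragradient_step X0 clX cX (eps_ge0 k) (gam_ge0 k)
    g_bnd (@G_eps k) (@xj_in k j jQ) Xz (xhE k jQ) (xjE k jQ).
  exact.
apply: (@robbins_siegmund _ _ (fun k => Q.+1%:R * (gam k * eps k))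
  (fun k => Q.+1%:R * v k)).
- by move=> k; exact: sqr_ge0.
- by move=> k; rewrite mulr_ge0.
- by move=> k; rewrite mulr_ge0.
- by move=> k; exact: gap_ge0.
- exact: bounded_sumsZ.
- exact: bounded_sumsZ.
move=> k; rewrite xE -(xj0 k).
apply: (@iterated_growth _ (fun j => enorm (xj k j - z) ^+ 2)) => //.
- exact: gap_ge0.
- exact: step.
move=> j jQ; apply: le_trans (step k j jQ) _.
by rewrite gerBl gap_ge0.
Qed.

Let xh_near e : 0 < e ->
  exists N, forall k, (N <= k)%N -> enorm (x k - xh k 0%N) <= e.
Proof.
move=> e0; have e2 : 0 < e / 2 by rewrite divr_gt0.
have [z [Xz _]] := F_min.
have B0 : 0 <= B by apply: le_trans (g_bnd Xz); exact: enorm_ge0.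
have eB : 0 < (e / 2 / (B + 1)) ^+ 2 by rewrite exprn_gt0// divr_gt0// ltr_wpDl.
have [N1 H1] := bounded_sums_to0 (fun k => sqr_ge0 (gam k)) gam2_sum eB.
have [N2 H2] := bounded_sums_to0 gam_eps_ge0 gam_eps_sum e2.
exists (maxn N1 N2) => k; rewrite geq_max => /andP[/H1 k1 /H2 k2].
have [+ _] := extragradient_step X0 clX cX (eps_ge0 k) (gam_ge0 k)
    g_bnd (@G_eps k) (@xj_in k 0%N isT) Xz (xhE k (ltn0Sn _)) (xjE k (ltn0Sn _)).
rewrite xj0 => /le_trans; apply; rewrite mulrDr.
move: k1; rewrite ler_pXn2r ?nnegrE//; last first.
  by rewrite divr_ge0// ?(ltW e2)// addr_ge0.
rewrite ler_pdivlMr ?ltr_wpDl// mulrDr => k1.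
by have := gam_ge0 k; lra.
Qed.

(** The gaps weighted by the non-summable [gam] are summable. *)
Let gap_small z e N : is_argmin F X z -> 0 < e ->
  exists2 k, (N <= k)%N & gap z k <= e.
Proof.
move=> zmin e0; apply: contrapT => H; apply: gam_sum.
have [bg _] := quasi_fejer zmin.
have e2 : 0 <= (2 * e)^-1 by rewrite invr_ge0 mulr_ge0// ltW.
apply: (bounded_sums_le_near (N0 := N) _ (bounded_sumsZ e2 bg)) => k.
  rewrite !mulr_ge0// (pseudoconvex_minty cX F_grad F_pseudo zmin)//.
  exact: xh_in.
move=> Nk; rewrite ler_pdivlMl ?mulr_gt0// mulrAC ler_pM2l ?mulr_gt0//.
by rewrite leNgt; apply/negP => ge; apply: H; exists k => //; exact: ltW.
Qed.

(** The gap of some minimiser [z] tends to [0] along a subsequence, which can be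
    taken to converge to some [xbar].  There [dotv (g xbar) (xbar - z)] vanishes,
    and pseudoconvexity makes [xbar] a minimiser.  The distance to [xbar] thus
    converges, and its limit is [0] because of the subsequence. *)
Theorem extragradient_cvg : exists xbar,
  [/\ X xbar, x @ \oo --> xbar & forall y, X y -> 0 <= dotv (g xbar) (y - xbar)].
Proof.
have [z zmin] := F_min; have [Xz zle] := zmin.
have [_ [l /cvgrPdist_le xl]] := quasi_fejer zmin.
have [N _ HN] := xl _ ltr01.
have r0 : 0 <= l + 1.
  have := HN N (leqnn N); rewrite /= ler_norml => /andP[h _].
  by have := sqr_ge0 (enorm (x N - z)); lra.
have gapm m : exists k, (N + m <= k)%N /\ gap z k <= m.+1%:R^-1.
  by have [k mk gk] := @gap_small z m.+1%:R^-1 (N + m) zmin (ltac:(by [])); exists k.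
have [ks /all_and2[ksm ksg]] := choice gapm.
have [||xbar Xb clb] := @bounded_cluster_point _ _ X clX (x \o ks) z (Num.sqrt (l + 1)).
- by move=> m; exact: x_in_all.
- move=> m /=; rewrite enorm_distC -(@ler_pXn2r _ 2) ?nnegrE ?enorm_ge0 ?sqrtr_ge0//.
  rewrite (sqr_sqrtr r0).
  have := HN (ks m) (leq_trans (leq_addr _ _) (ksm m)).
  by rewrite /= ler_norml => /andP[h _]; lra.
have clx e M : 0 < e -> exists2 k, (M <= k)%N & enorm (x k - xbar) <= e.
  move=> e0; have [m Mm h] := clb e M e0; exists (ks m) => //.
  by rewrite (leq_trans Mm)// (leq_trans (leq_addl N m)).
have B0 : 0 <= B by apply: le_trans (g_bnd Xz); exact: enorm_ge0.
have L0 : 0 <= `|L| by [].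
pose D := enorm (xbar - z).
have D0 : 0 <= D by exact: enorm_ge0.
have gapbar : dotv (g xbar) (xbar - z) <= 0.
  apply/ler_addgt0Pl => e e0; rewrite addr0.
  (* [C] bounds the change of the gap between [xbar] and a nearby [y], per unit
     of distance. *)
  pose C := `|L| * D + B + 1.
  have C0 : 0 < C by rewrite ltr_wpDl// addr_ge0// mulr_ge0.
  have e1 : 0 < e / (4 * C) by rewrite divr_gt0// mulr_gt0.
  have e2 : 0 < e / 2 by rewrite divr_gt0.
  have [N1 HN1] := xh_near e1.
  have [N2 _ HN2] := near_infty_natSinv_lt (PosNum e2).
  have [m mN mb] := clb _ (maxn N1 N2) e1.
  move: mN; rewrite geq_max => /andP[m1 m2].
  have km : (N1 <= ks m)%N by rewrite (leq_trans m1)// (leq_trans (leq_addl N m)).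
  have hm' : m.+1%:R^-1 < e / 2 := HN2 _ m2.
  have := ksg m; rewrite /gap; have := HN1 _ km; move: hm'.
  have := xh_in (ks m) (ltn0Sn Q); set y := xh (ks m) 0%N => Xy hm hy hg.
  have by_ : enorm (xbar - y) <= e / (2 * C).
    apply: le_trans (ler_enorm_dist _ (x (ks m)) _) _; rewrite enorm_distC.
    have -> : e / (2 * C) = e / (4 * C) + e / (4 * C) by field; rewrite gt_eqF.
    exact: lerD.
  have -> : dotv (g xbar) (xbar - z) = dotv (g y) (y - z)
      + (dotv (g xbar - g y) (xbar - z) + dotv (g y) (xbar - y)).
    by rewrite !dotvE; ring.
  have hB : dotv (g y) (xbar - y) <= B * enorm (xbar - y).
    apply: le_trans (dotv_le_enorm _ _) _.
    by rewrite ler_wpM2r ?enorm_ge0// g_bnd.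
  have hL : dotv (g xbar - g y) (xbar - z) <= `|L| * enorm (xbar - y) * D.
    apply: le_trans (dotv_le_enorm _ _) _; rewrite ler_wpM2r//.
    apply: le_trans (g_lip Xb Xy) _; rewrite ler_wpM2r ?enorm_ge0//.
    exact: ler_norm.
  have hC : C * enorm (xbar - y) <= e / 2.
    rewrite mulrC -ler_pdivlMr//; apply: le_trans by_ _.
    by rewrite -mulrA -invfM.
  have hge : dotv (g y) (y - z) <= e / 2 by exact: le_trans hg (ltW hm).
  move: hge hC hL hB (enorm_ge0 (xbar - y)); rewrite /C.
  move: (dotv _ _) (dotv _ _) (dotv _ _) (enorm _) `|L|.
  by move=> d1 d2 d3 ed l1 h1 h2 h3 h4 h5; lra.
have xbmin : is_argmin F X xbar.
  split=> // y Xy; apply: le_trans (zle _ Xy); apply: (F_pseudo Xb Xz).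
  by rewrite -opprB dotvNr oppr_ge0.
exists xbar; split=> //; last first.
  exact: (argmin_first_order cX xbmin (F_grad Xb)).
have [_ [l' /cvgrPdist_le xl']] := quasi_fejer xbmin.
apply: cvg_enorm => e e0.
have e4 : 0 < e ^+ 2 / 4 by rewrite divr_gt0// exprn_gt0.
(* Beyond [N1] squared distances differ by at most [e ^+ 2 / 2], and one of them
   is at most [e ^+ 2 / 4]. *)
have [N1 _ HN1] := xl' _ e4; exists N1 => k kN1.
have e2 : 0 < e / 2 by rewrite divr_gt0.
have [k0 k0N1] := clx _ N1 e2.
rewrite -(@ler_pXn2r _ 2) ?nnegrE ?enorm_ge0 ?(ltW e2)// => hk0.
rewrite -(@ler_pXn2r _ 2) ?nnegrE ?enorm_ge0 ?(ltW e0)//.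
have := HN1 k kN1; have := HN1 k0 k0N1; rewrite /= !ler_norml.
by move: hk0 => + /andP[h1 h2] /andP[h3 h4]; rewrite expr_div_n; lra.
Qed.

End Extragradient.

(** * Orthogonality of a centred variable *)

Section Orthogonality.
Context {R : realType} {d : measure_display} {T : measurableType d}.
Context (P : {measure set T -> \bar R}) (A : set T) (mA : measurable A).

Lemma le_integrable_norm (u v : T -> R) : measurable_fun A u ->
  (forall t, A t -> `|u t| <= v t) ->
  P.-integrable A (EFin \o v) -> P.-integrable A (EFin \o u).
Proof.
move=> mu uv iv; apply: (le_integrable mA _ _ iv); first exact/measurable_EFinP.
move=> t At; rewrite /= lee_fin; apply: le_trans (uv t At) (ler_norm _).
Qed.

Import HBNNSimple.

Context (W D : T -> R) (iW : P.-integrable A (EFin \o W)).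
Context (mD : measurable_fun A D).
Context (WD0 : forall B : set R, measurable B ->
  (\int[P]_(t in A `&` D @^-1` B) (W t)%:E = 0)%E).

Let mW : measurable_fun A W.
Proof. by apply/measurable_EFinP; case/integrableP: iW. Qed.

Let iaW : P.-integrable A (EFin \o (fun t => `|W t|)).
Proof.
apply: (le_integrable mA _ _ iW).
  by apply/measurable_EFinP; exact: measurableT_comp.
by move=> t _; rewrite /= lee_fin normr_id.
Qed.

Let integral_simple0 (phi : {nnsfun R >-> R}) :
  (\int[P]_(t in A) (W t * phi (D t))%:E = 0)%E.
Proof.
have mE y : measurable (phi @^-1` [set y]) by exact: measurable_funPTI.
have mI y : measurable_fun A ((\1_(phi @^-1` [set y]) : _ -> R) \o D).
  exact: (@measurableT_comp _ _ _ _ R).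
have iy y : P.-integrable A (fun t => (y * (W t * \1_(phi @^-1` [set y]) (D t)))%:E).
  apply: (@le_integrable_norm _ (fun t => `|y| * `|W t|)).
  - by apply: measurable_funM => //; apply: measurable_funM => //; exact: mI.
  - move=> t At; rewrite !normrM ler_wpM2l// ler_piMr// indicE.
    by case: (_ \in _); rewrite ?normr1 ?normr0.
  exact: (integrableZl mA `|y| iaW).
under eq_integral => t _.
  rewrite (fimfunE phi (D t)) fsbig_finite//= mulr_sumr -sumEFin.
  under eq_bigr do rewrite mulrCA.
  over.
rewrite (integral_sum mA iy) big1// => y _.
under eq_integral do rewrite EFinM.
rewrite integralZl//; last first.
  apply: (@le_integrable_norm _ (fun t => `|W t|)).
  - by apply: measurable_funM => //; exact: mI.
  - move=> t At; rewrite !normrM ler_piMr// indicE.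
    by case: (_ \in _); rewrite ?normr1 ?normr0.
  exact: iaW.
rewrite [X in (_ * X)%E](_ : _ = 0)%E ?mule0//.
rewrite -(WD0 (mE y)) integral_mkcondr; apply: eq_integral => t _.
rewrite /restrict indicE; case: ifPn => tE.
  by rewrite mem_set ?mulr1//; move/set_mem: tE.
by rewrite memNset ?mulr0// => h; move/negP: tE; apply; exact: mem_set.
Qed.

Lemma integral_mul_funpos_eq0 : P.-integrable A (fun t => (W t * D t)%:E) ->
  (\int[P]_(t in A) (W t * Num.max (D t) 0)%:E = 0)%E.
Proof.
move=> iWD; pose pos (s : R) : \bar R := (Num.max s 0)%:E.
have mpos : measurable_fun setT pos.
  by apply/measurable_EFinP; apply: measurable_maxr => //; exact: measurable_id.
have pos0 (s : R) : setT s -> (0 <= pos s)%E.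
  by move=> _; rewrite lee_fin le_max lexx orbT.
pose phi := nnsfun_approx measurableT mpos.
have phi_le m (s : R) : 0 <= phi m s <= `|s|.
  apply/andP; split; first exact: fun_ge0.
  have : ((phi m s)%:E <= pos s)%E by rewrite nnsfun_approxE le_approx.
  by rewrite lee_fin => /le_trans; apply; rewrite ge_max ler_norm normr_ge0.
have [|||||_ _] := @dominated_convergence _ _ _ P _ mA
    (fun m t => (W t * phi m (D t))%:E) (fun t => (W t * Num.max (D t) 0)%:E)
    (fun t => `|(W t * D t)%:E|%E).
- move=> m; apply/measurable_EFinP; apply: measurable_funM => //.
  by apply: (measurableT_comp (f := phi m)).
- by apply/measurable_EFinP; apply: measurable_funM => //; apply: measurable_maxr.
- apply: aeW => t At; apply/fine_cvgP; split; first exact: nearW.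
  apply: cvgMr; have /fine_cvgP[_] := cvg_nnsfun_approx measurableT mpos pos0 (x := D t) Logic.I.
  exact.
- exact: integrable_abse.
- apply: aeW => t m At /=; rewrite lee_fin !normrM ler_wpM2l//.
  by have /andP[p0 p1] := phi_le m (D t); rewrite ger0_norm.
under eq_fun do rewrite integral_simple0.
by move=> /cvg_lim <-//; rewrite lim_cst.
Qed.

End Orthogonality.

(** A form of the pull-out property of conditional expectations: the hypothesis on
    [W] gives the claim at once for simple functions of [D], and these
    approximate the positive and negative parts of [D]. *)
Lemma integral_mul_eq0 {R : realType} {d} {T : measurableType d}
    (P : {measure set T -> \bar R}) (A : set T) (W D : T -> R) :
  measurable A -> P.-integrable A (EFin \o W) -> measurable_fun A D ->
  (forall B : set R, measurable B ->
    (\int[P]_(t in A `&` D @^-1` B) (W t)%:E = 0)%E) ->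
  P.-integrable A (fun t => (W t * D t)%:E) ->
  (\int[P]_(t in A) (W t * D t)%:E = 0)%E.
Proof.
move=> mA iW mD WD0 iWD.
have posD := integral_mul_funpos_eq0 mA iW mD WD0 iWD.
have mW : measurable_fun A W by apply/measurable_EFinP; case/integrableP: iW.
have mND : measurable_fun A (fun t => - D t) by exact: measurableT_comp.
have negD : (\int[P]_(t in A) (W t * Num.max (- D t) 0)%:E = 0)%E.
  apply: integral_mul_funpos_eq0 => //.
    move=> B mB; rewrite -(WD0 (-%R @^-1` B))//.
    by rewrite -[X in measurable X]setTI; exact: oppr_measurable.
  apply: (le_integrable mA _ _ iWD).
    by apply/measurable_EFinP; exact: measurable_funM.
  by move=> t _ /=; rewrite lee_fin mulrN normrN.
have iM (E : T -> R) : measurable_fun A E -> (forall t, `|Num.max (E t) 0| <= `|D t|) ->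
    P.-integrable A (fun t => (W t * Num.max (E t) 0)%:E).
  move=> mE ED; apply: (le_integrable mA _ _ iWD).
    apply/measurable_EFinP; apply: measurable_funM => //.
    exact: measurable_maxr.
  by move=> t _ /=; rewrite lee_fin !normrM ler_wpM2l.
have max_le (s : R) : `|Num.max s 0| <= `|s|.
  by rewrite ger0_norm ?le_max ?lexx ?orbT// ge_max ler_norm normr_ge0.
under eq_integral => t _.
  rewrite (_ : W t * D t = W t * Num.max (D t) 0 - W t * Num.max (- D t) 0).
    rewrite EFinB; over.
  rewrite -mulrBr; congr (_ * _).
  by case: (lerP 0 (D t)) => h; [rewrite max_r ?subr0 // oppr_le0|
    rewrite max_l ?sub0r ?opprK // oppr_ge0 ltW].
rewrite integralB//= ?posD ?negD ?sube0//.
  exact: iM.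
by apply: iM => // t; rewrite (le_trans (max_le _))// normrN.
Qed.

(** * Measurability of random vectors *)

Section RandomVectors.
Context {R : realType} {d : measure_display} {T : measurableType d}.

Lemma random_vectorP {p} (v : T -> 'rV[R]_p) :
  random_vector v <-> forall j, measurable_fun setT (fun t => v t 0 j).
Proof.
split=> [mv j|mv u [j ->]]; last exact: mv.
by apply: mv; exists j.
Qed.

Lemma random_vector_cst {p} (c : 'rV[R]_p) : random_vector (fun _ : T => c).
Proof. by apply/random_vectorP => j; exact: measurable_cst. Qed.

Lemma random_vectorD {p} (u v : T -> 'rV[R]_p) :
  random_vector u -> random_vector v -> random_vector (fun t => u t + v t).
Proof.
move=> /random_vectorP mu /random_vectorP mv; apply/random_vectorP => j.
rewrite (_ : (fun t => _) = (fun t => u t 0 j + v t 0 j)).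
  exact: measurable_funD.
by apply/funext => t; rewrite !mxE.
Qed.

Lemma random_vectorZ {p} (c : R) (v : T -> 'rV[R]_p) :
  random_vector v -> random_vector (fun t => c *: v t).
Proof.
move=> /random_vectorP mv; apply/random_vectorP => j.
rewrite (_ : (fun t => _) = (fun t => c * v t 0 j)).
  by apply: measurable_funM => //; exact: measurable_cst.
by apply/funext => t; rewrite !mxE.
Qed.

Lemma random_vectorB {p} (u v : T -> 'rV[R]_p) :
  random_vector u -> random_vector v -> random_vector (fun t => u t - v t).
Proof.
move=> mu mv; rewrite (_ : (fun t => _) = (fun t => u t + (-1) *: v t)).
  exact/random_vectorD/random_vectorZ.
by apply/funext => t; rewrite scaleN1r.
Qed.

Lemma measurable_dotv {p} (u v : T -> 'rV[R]_p) :
  random_vector u -> random_vector v -> measurable_fun setT (fun t => dotv (u t) (v t)).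
Proof.
move=> /random_vectorP mu /random_vectorP mv.
by apply: measurable_sum => j; exact: measurable_funM.
Qed.

Lemma measurable_enorm_sqr {p} (v : T -> 'rV[R]_p) :
  random_vector v -> measurable_fun setT (fun t => enorm (v t) ^+ 2).
Proof.
move=> mv; rewrite (_ : (fun t => _) = (fun t => dotv (v t) (v t))).
  exact: measurable_dotv.
by apply/funext => t; rewrite enorm_sqr.
Qed.

(** Rounding every coordinate of [v] down to a multiple of [1 / m.+1] yields
    vectors with countably many values that converge to [v]. *)
Lemma measurable_lipschitz_comp {p} (v : T -> 'rV[R]_p) (phi : 'rV[R]_p -> R) L :
  (forall u u', `|phi u - phi u'| <= L * enorm (u - u')) ->
  random_vector v -> measurable_fun setT (fun t => phi (v t)).
Proof.
move=> phiL /random_vectorP mv.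
pose code m t : 'rV[int]_p := \row_j Num.floor (m.+1%:R * v t 0 j).
pose dec m (z : 'rV[int]_p) : 'rV[R]_p := \row_j ((z 0 j)%:~R / m.+1%:R).
apply: (@measurable_fun_cvg _ _ _ _ (fun m t => phi (dec m (code m t)))).
  move=> m _ B mB; rewrite setTI.
  pose cell (z : 'rV[int]_p) := [set t | code m t = z].
  have mcell z : measurable (cell z).
    rewrite [cell z](_ : _ = \bigcap_(j in [set: 'I_p])
        (fun t => m.+1%:R * v t 0 j) @^-1` `[(z 0 j)%:~R, (z 0 j + 1)%:~R[).
      apply: fin_bigcap_measurable => // j _.
      rewrite -[X in measurable X]setTI.
      have mvj : measurable_fun setT (fun t => m.+1%:R * v t 0 j).
        by apply: measurable_funM => //; exact: measurable_cst.
      by apply: mvj => //; exact: measurable_itv.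
    apply/seteqP; split => [t <- j _ /=|t H].
      by rewrite in_itv/= mxE floor_itv.
    apply/rowP => j; rewrite mxE; apply: floor_def.
    by have := H j Logic.I; rewrite /= in_itv.
  rewrite [X in measurable X](_ : _ = \bigcup_k
      (if unpickle k is Some z then if `[< B (phi (dec m z)) >] then cell z else set0
       else set0)).
    apply: bigcupT_measurable => k; case: unpickle => // z.
    by case: ifP.
  apply/seteqP; split => [t Bt|t [k _]].
    by exists (pickle (code m t)) => //; rewrite pickleK asboolT.
  by case: unpickle => // z; case: asboolP => // Bz ct; rewrite /preimage/= (ct : code m t = z).
move=> t _; apply/cvgrPdist_le => e e0.
have C0 : 0 < p.+1%:R * (`|L| + 1) :> R by rewrite mulr_gt0// ltr_wpDl.
have [N _ HN] := near_infty_natSinv_lt (PosNum (divr_gt0 e0 C0)).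
exists N => // m /= /HN /= mN.
apply: le_trans (phiL _ _) _.
have dist : enorm (v t - dec m (code m t)) <= p.+1%:R * m.+1%:R^-1.
  apply: le_trans (ler_enorm_norm _) _; rewrite ler_wpM2l//.
  rewrite -[leLHS]/(mx_norm _) mx_normrE; apply: bigmax_le => [|[i j] _ /=].
    by rewrite invr_ge0.
  rewrite (ord1 i) !mxE.
  have /andP[f1 f2] := floor_itv (m.+1%:R * v t 0 j).
  have m0 : 0 < m.+1%:R :> R by [].
  rewrite -(ler_pM2l m0) -{1}(gtr0_norm m0) -normrM mulfV ?gt_eqF//.
  rewrite mulrBr mulrCA mulfV ?gt_eqF// mulr1.
  by move: f2; rewrite intrD => f2; rewrite ger0_norm; lra.
apply: (@le_trans _ _ ((`|L| + 1) * (p.+1%:R * m.+1%:R^-1))).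
  apply: (@le_trans _ _ (`|L| * enorm (v t - dec m (code m t)))).
    by rewrite ler_wpM2r ?enorm_ge0// ler_norm.
  by rewrite ler_pM ?enorm_ge0// lerDl.
apply: (@le_trans _ _ ((`|L| + 1) * (p.+1%:R * (e / (p.+1%:R * (`|L| + 1)))))).
  by rewrite ler_wpM2l ?addr_ge0// ler_wpM2l// ltW.
by rewrite [leLHS]mulrA (mulrC (_ + 1)) [leLHS]mulrC divfK // gt_eqF.
Qed.

Lemma random_vector_lipschitz {p q} (v : T -> 'rV[R]_p) (phi : 'rV[R]_p -> 'rV[R]_q) L :
  (forall u u', enorm (phi u - phi u') <= L * enorm (u - u')) ->
  random_vector v -> random_vector (fun t => phi (v t)).
Proof.
move=> phiL mv; apply/random_vectorP => j.
apply: (@measurable_lipschitz_comp _ v (fun u => phi u 0 j) L _ mv) => u u'.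
apply: le_trans (phiL u u').
by have := ler_coord_enorm (phi u - phi u') j; rewrite !mxE.
Qed.

End RandomVectors.

(** * One noisy learning step *)

Section LearningStep.
Context {R : realType} {p : nat} (Theta : set 'rV[R]_p).
Context (Theta0 : Theta !=set0) (clTheta : closed Theta).
Context (cTheta : convex_set (Theta : set (convex_lmodType 'rV[R]_p))).
Context (gh : 'rV[R]_p -> 'rV[R]_p) (mu L : R) (ths : 'rV[R]_p).
Context (L0 : 0 < L) (ths_in : Theta ths).
Context (gh_sc : strongly_convex_grad Theta gh mu).
Context (gh_lip : forall u v, Theta u -> Theta v ->
  enorm (gh u - gh v) <= L * enorm (u - v)).
Context (ths_stat : forall y, Theta y -> 0 <= dotv (gh ths) (y - ths)).

(** A point satisfying the variational inequality is a fixed point of the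
    projected gradient map. *)
Lemma proj_stationary b : 0 <= b -> Defs.proj Theta (ths - b *: gh ths) = ths.
Proof.
move=> b0; set y := Defs.proj _ _.
have := proj_obtuse Theta0 clTheta cTheta (ths - b *: gh ths) ths_in.
rewrite -/y => H.
have Ty : Theta y by exact: proj_in.
have := mulr_ge0 b0 (ths_stat Ty).
move=> H2; apply/eqP; rewrite eq_sym -subr_eq0; apply/eqP/enorm_le0.
rewrite -(@ler_pXn2r _ 2) ?nnegrE ?enorm_ge0// expr0n /= enorm_sqr.
by move: H H2; rewrite !dotvE; lra.
Qed.

(** Bounds the square of the Lipschitz constant of [u - b *: gh u] on [Theta]. *)
Definition contraction_factor b := 1 - 2 * b * mu + b ^+ 2 * L ^+ 2.

(** The displacement from [ths] after a noiseless and unprojected step, [ths]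
    being moved by its own gradient as well. *)
Definition drift b (u : 'rV[R]_p) := u - ths - b *: (gh u - gh ths).

Lemma drift_contraction b u : 0 <= b -> Theta u ->
  enorm (drift b u) ^+ 2 <= contraction_factor b * enorm (u - ths) ^+ 2.
Proof.
move=> b0 Tu; rewrite /drift (enormB_sqr (u - ths)) dotvZr enormZ (ger0_norm b0) exprMn.
rewrite dotvC; have := ler_wpM2l b0 (gh_sc Tu ths_in).
have : enorm (gh u - gh ths) ^+ 2 <= L ^+ 2 * enorm (u - ths) ^+ 2.
  rewrite -exprMn ler_pXn2r ?nnegrE ?mulr_ge0 ?enorm_ge0 ?(ltW L0)//.
  exact: gh_lip.
move=> /(ler_wpM2l (sqr_ge0 b)); rewrite /contraction_factor; lra.
Qed.

(** The minimiser [ths] is the image of [ths - b *: gh ths] under the projection,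
    and projecting does not increase distances. *)
Lemma learning_step b u w : 0 <= b -> Theta u ->
  enorm (Defs.proj Theta (u - b *: (gh u + w)) - ths) ^+ 2 <=
  enorm (drift b u) ^+ 2 - 2 * b * dotv w (drift b u) + b ^+ 2 * enorm w ^+ 2.
Proof.
move=> b0 Tu; rewrite -[X in _ - X](proj_stationary b0).
apply: (@le_trans _ _ (enorm (drift b u - b *: w) ^+ 2)).
  rewrite ler_pXn2r ?nnegrE ?enorm_ge0//.
  apply: le_trans (proj_nonexpansive Theta0 clTheta cTheta _ _) _.
  rewrite (_ : u - b *: (gh u + w) - _ = drift b u - b *: w)//.
  apply/rowP => j; rewrite !mxE; ring.
by rewrite enormB_sqr dotvZr enormZ (ger0_norm b0) exprMn dotvC; lra.
Qed.

Context {d : measure_display} {T : measurableType d} (P : probability T R).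

(** The values of [gh] outside [Theta] are arbitrary; on [Theta] it coincides
    with the Lipschitz map obtained by first projecting. *)
Lemma random_gradient {d'} {T' : measurableType d'} (u : T' -> 'rV[R]_p) :
  (forall t, Theta (u t)) -> random_vector u -> random_vector (fun t => gh (u t)).
Proof.
move=> Tu mu_.
rewrite (_ : (fun t => _) = (fun t => gh (Defs.proj Theta (u t)))); last first.
  by apply/funext => t; rewrite proj_id.
apply: (@random_vector_lipschitz _ _ _ _ _ u
  (fun v => gh (Defs.proj Theta v)) L) => //.
move=> v v'; apply: le_trans (gh_lip _ _) _; [exact: proj_in|exact: proj_in|].
by rewrite ler_pM2l// proj_nonexpansive.
Qed.

Lemma random_drift b {d'} {T' : measurableType d'} (u : T' -> 'rV[R]_p) :
  (forall t, Theta (u t)) -> random_vector u -> random_vector (fun t => drift b (u t)).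
Proof.
move=> Tu mu_; apply: random_vectorB; first exact/random_vectorB/random_vector_cst.
apply/random_vectorZ/random_vectorB; last exact: random_vector_cst.
exact: random_gradient.
Qed.

Lemma random_learning_step b (u w : T -> 'rV[R]_p) :
  (forall t, Theta (u t)) -> random_vector u -> random_vector w ->
  random_vector (fun t => Defs.proj Theta (u t - b *: (gh (u t) + w t))).
Proof.
move=> Tu mu_ mw.
apply: (@random_vector_lipschitz _ _ _ _ _ _ (Defs.proj Theta) 1).
  by move=> v v'; rewrite mul1r proj_nonexpansive.
apply/(random_vectorB mu_)/random_vectorZ/random_vectorD => //.
exact: random_gradient.
Qed.

Context (Gs : set (set T)).
Let TG : measurableType _ := g_sigma_algebraType Gs.

Context (A : set T) (mA : measurable A) (GA : <<s Gs>> A).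
Context (u w : T -> 'rV[R]_p) (Tu : forall t, Theta (u t)).
Context (mu_ : random_vector u) (Gu : @random_vector R _ TG p u).
Context (mw : random_vector w).
Context (iw : forall j, P.-integrable setT (fun t => (w t 0 j)%:E)).
Context (w0 : forall j S, <<s Gs>> S -> (\int[P]_(t in S) (w t 0 j)%:E = 0)%E).
Context (iw2 : P.-integrable setT (fun t => (enorm (w t) ^+ 2)%:E)).
Context (b : R) (b0 : 0 <= b).
Context (ir : P.-integrable A (fun t => (enorm (u t - ths) ^+ 2)%:E)).

Let iw2A : P.-integrable A (EFin \o (fun t => enorm (w t) ^+ 2)).
Proof. exact: (integrableS measurableT). Qed.

Let mdrift : random_vector (fun t => drift b (u t)).
Proof. exact: random_drift. Qed.

Let idrift : P.-integrable A (EFin \o (fun t => enorm (drift b (u t)) ^+ 2)).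
Proof.
apply: (le_integrable_norm mA (v := fun t => contraction_factor b * enorm (u t - ths) ^+ 2)).
- by apply: measurable_funTS; exact: measurable_enorm_sqr.
- by move=> t _; rewrite ger0_norm ?sqr_ge0// drift_contraction.
exact: (integrableZl mA (contraction_factor b) ir).
Qed.

Let iprod j : P.-integrable A (EFin \o (fun t => w t 0 j * drift b (u t) 0 j)).
Proof.
apply: (le_integrable_norm mA
  (v := fun t => enorm (w t) ^+ 2 + enorm (drift b (u t)) ^+ 2)).
- apply: measurable_funTS; apply: measurable_funM.
    exact: (random_vectorP w).1.
  exact: (random_vectorP _).1.
- move=> t _; rewrite normrM.
  have h1 := ler_coord_enorm (w t) j; have h2 := ler_coord_enorm (drift b (u t)) j.
  apply: (@le_trans _ _ (enorm (w t) * enorm (drift b (u t)))).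
    by rewrite ler_pM.
  have := sqr_ge0 (enorm (w t) - enorm (drift b (u t))).
  have := sqr_ge0 (enorm (w t)); have := sqr_ge0 (enorm (drift b (u t))).
  lra.
exact: (integrableD mA iw2A idrift).
Qed.

Let idot : P.-integrable A (EFin \o (fun t => dotv (w t) (drift b (u t)))).
Proof.
rewrite (_ : _ \o _ = (fun t => \sum_(j < p) (w t 0 j * drift b (u t) 0 j)%:E)%E).
  by apply: integrable_sum => // j _; exact: iprod.
by apply/funext => t /=; rewrite sumEFin.
Qed.

(** [w] has zero integral on every event of the history [<<s Gs>>], and the drift
    is a function of [u], which that history determines. *)
Lemma noise_orthogonal : \int[P]_(t in A) dotv (w t) (drift b (u t)) = 0.
Proof.
rewrite /Rintegral; under eq_integral do rewrite /dotv -sumEFin.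
rewrite (integral_sum mA iprod) big1// => j _.
apply: integral_mul_eq0 => //; last exact: iprod.
- by apply: (integrableS measurableT) => //; exact: iw.
- by apply: measurable_funTS; exact: (random_vectorP _).1.
move=> B mB; apply: w0.
have GD : @random_vector R _ TG p (fun t => drift b (u t)) by exact: random_drift.
have := (@random_vectorP R _ TG _ _).1 GD j measurableT B mB.
by rewrite setTI => mDB; exact: (@measurableI _ TG).
Qed.

Let r1 t := enorm (Defs.proj Theta (u t - b *: (gh (u t) + w t)) - ths) ^+ 2.

Lemma learning_moment_integrable : P.-integrable A (EFin \o r1).
Proof.
apply: (le_integrable_norm mA (v := fun t => enorm (drift b (u t)) ^+ 2 -
   2 * b * dotv (w t) (drift b (u t)) + b ^+ 2 * enorm (w t) ^+ 2)).
- apply: measurable_funTS; apply: measurable_enorm_sqr.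
  apply: random_vectorB; last exact: random_vector_cst.
  exact: random_learning_step.
- by move=> t _; rewrite ger0_norm ?sqr_ge0// learning_step.
exact: (integrableD mA (integrableB mA idrift (integrableZl mA (2 * b) idot))
  (integrableZl mA (b ^+ 2) iw2A)).
Qed.

Lemma learning_moment_le :
  \int[P]_(t in A) r1 t <= contraction_factor b * \int[P]_(t in A) enorm (u t - ths) ^+ 2
    + b ^+ 2 * \int[P]_(t in setT) enorm (w t) ^+ 2.
Proof.
have i1 := integrableZl mA (contraction_factor b) ir.
have i2 := integrableZl mA (2 * b) idot.
have i3 := integrableZl mA (b ^+ 2) iw2A.
apply: (@le_trans _ _ (\int[P]_(t in A) (contraction_factor b * enorm (u t - ths) ^+ 2
    - 2 * b * dotv (w t) (drift b (u t)) + b ^+ 2 * enorm (w t) ^+ 2))).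
  apply: (le_Rintegral mA learning_moment_integrable).
    exact: (integrableD mA (integrableB mA i1 i2) i3).
  move=> t _; apply: le_trans (learning_step _ b0 (Tu t)) _.
  by rewrite !lerD2r drift_contraction.
rewrite RintegralD//; last exact: (integrableB mA i1 i2).
rewrite RintegralB// !RintegralZl// noise_orthogonal mulr0 subr0 lerD2l.
rewrite ler_wpM2l ?sqr_ge0// /Rintegral fine_le//.
- exact: integrable_fin_num.
- exact: integrable_fin_num.
apply: ge0_subset_integral => //.
- by apply/measurable_EFinP; exact: measurable_enorm_sqr.
- by move=> t _; rewrite lee_fin sqr_ge0.
Qed.

End LearningStep.

(** * Summability of the learning error *)

Section NoiseHistory.
Context {R : realType} {d : measure_display} {T : measurableType d}.
Context (P : probability T R).

Lemma sigma_gen_random_vector {p} (U : set (T -> R)) (v : T -> 'rV[R]_p) :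
  coords v `<=` U ->
  @random_vector R _ (g_sigma_algebraType
    (\bigcup_(u in U) preimage_set_system setT u measurable)) p v.
Proof.
move=> vU u /vU Uu _ B mB; apply: sub_sigma_algebra.
by exists u => //; exists B.
Qed.

(** Since [Z] is only almost surely at most [c], and need not be nonnegative,
    it is compared with [c] through its positive part. *)
Lemma cond_exp_le (G : set (set T)) (Y Z : T -> R) c : 0 <= c ->
  is_cond_exp P G Y Z -> G setT -> {ae P, forall t, Z t <= c} ->
  \int[P]_(t in setT) Y t <= c.
Proof.
move=> c0 [iY [iZ [_ YZ]]] GT Zc.
have mZ : measurable_fun setT Z by apply/measurable_EFinP; case/integrableP: iZ.
pose Zp t := Num.max (Z t) 0.
have mZp : measurable_fun setT Zp by exact: measurable_maxr.
have iZp : P.-integrable setT (EFin \o Zp).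
  apply: (le_integrable measurableT _ _ iZ); first exact/measurable_EFinP.
  move=> t _; rewrite /= lee_fin [leLHS]ger0_norm /Zp ?le_max ?lexx ?orbT//.
  by rewrite ge_max ler_norm normr_ge0.
have le1 : (\int[P]_t (Z t)%:E <= \int[P]_t (Zp t)%:E)%E.
  by apply: le_integral => // t _; rewrite lee_fin le_max lexx.
have le2 : (\int[P]_t (Zp t)%:E <= \int[P]_t (cst c%:E t))%E.
  apply: ae_ge0_le_integral => //.
  - by move=> t _; rewrite lee_fin le_max lexx orbT.
  - exact/measurable_EFinP.
  - by apply: filterS Zc => t Zt _; rewrite lee_fin ge_max Zt.
rewrite integral_cst//= probability_setT mule1 in le2.
rewrite /Rintegral -(YZ _ GT) -lee_fin fineK; first exact: le_trans le1 le2.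
exact: integrable_fin_num.
Qed.

End NoiseHistory.

Section LearningPath.
Context {R : realType} {n p : nat} (Theta : set 'rV[R]_p).
Context (Theta0 : Theta !=set0) (clTheta : closed Theta).
Context (cTheta : convex_set (Theta : set (convex_lmodType 'rV[R]_p))).
Context (gh : 'rV[R]_p -> 'rV[R]_p) (mu L : R) (ths : 'rV[R]_p).
Context (mu0 : 0 < mu) (L0 : 0 < L) (ths_in : Theta ths).
Context (gh_sc : strongly_convex_grad Theta gh mu).
Context (gh_lip : forall u v, Theta u -> Theta v ->
  enorm (gh u - gh v) <= L * enorm (u - v)).
Context (ths_stat : forall y, Theta y -> 0 <= dotv (gh ths) (y - ths)).
Context (beta : nat -> R) (beta_gt0 : forall k, 0 < beta k).
Context (beta_le : forall k, beta k <= 2 * mu / L ^+ 2).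
Context (beta2_sum : bounded_sums (fun k => beta k ^+ 2)).
Context {d : measure_display} {T : measurableType d} (P : probability T R).
Context (nR : nat) (x : nat -> T -> 'rV[R]_n) (th : nat -> T -> 'rV[R]_p).
Context (w ti : nat -> nat -> T -> 'rV[R]_p) (nu : R).
Context (th0_random : random_vector (th 0%N)) (th0_in : forall t, Theta (th 0%N t)).
Context (ti0 : forall k, ti k 0%N = th k).
Context (tiS : forall k i, (i < nR.+1)%N -> ti k i.+1 =
  (fun t => Defs.proj Theta (ti k i t - beta k *: (gh (ti k i t) + w k i t)))).
Context (thS : forall k, th k.+1 = ti k nR.+1).
Context (noise : noise_conditions P x th w ti nR.+1 nu).

Let beta_ge0 k : 0 <= beta k. Proof. exact: ltW. Qed.

Let th_in k t : Theta (th k t).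
Proof. by case: k => // k; rewrite thS tiS//; exact: proj_in. Qed.

Let ti_in k i t : (i <= nR.+1)%N -> Theta (ti k i t).
Proof.
by case: i => [_|i iR]; [rewrite ti0; exact: th_in|rewrite tiS//; exact: proj_in].
Qed.

Let ti_random_from k : random_vector (th k) ->
  forall i, (i <= nR.+1)%N -> random_vector (ti k i).
Proof.
move=> rth; elim=> [_|i IH iR]; first by rewrite ti0.
rewrite tiS//; have [rw _] := noise k iR.
apply: (random_learning_step Theta0 clTheta cTheta L0 gh_lip) => //.
- by move=> t; apply: ti_in; exact: ltnW.
- by apply: IH; exact: ltnW.
Qed.

Let th_random k : random_vector (th k).
Proof. by elim: k => // k IH; rewrite thS; exact: ti_random_from. Qed.

Let ti_random k i : (i <= nR.+1)%N -> random_vector (ti k i).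
Proof. exact: ti_random_from. Qed.

Let r k i t := enorm (ti k i t - ths) ^+ 2.

Let history_coords k i : set (T -> R) :=
  \bigcup_(l in [set l | (l <= k)%N]) (coords (x l) `|` coords (th l)) `|`
  \bigcup_(l in [set l | (l < i)%N]) (coords (w k l) `|` coords (ti k l.+1)).

Let th0_history k i : coords (th 0%N) `<=` history_coords k i.
Proof. by move=> u hu; left; exists 0%N => //; right. Qed.

Let ti_history k i : coords (ti k i) `<=` history_coords k i.
Proof.
move=> u; case: i => [|i] hu; last by right; exists i => //=; right.
by left; exists k => //=; right; rewrite -ti0.
Qed.

(** No moment of the initial parameter is assumed, so second moments are taken
    on the events where it lies within a given distance of the minimiser; such
    an event belongs to every noise history. *)
Let start (M : nat) := [set t | enorm (th 0%N t - ths) ^+ 2 <= M%:R].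

Let start_measurable M : measurable (start M).
Proof.
have : measurable_fun setT (fun t => enorm (th 0%N t - ths) ^+ 2).
  by apply: measurable_enorm_sqr; exact/random_vectorB/random_vector_cst.
move=> /(_ measurableT _ (measurable_itv `]-oo, M%:R])); rewrite setTI.
by rewrite [X in measurable X -> _](_ : _ = start M).
Qed.

Let start_history M k i : noise_history x th w ti k i (start M).
Proof.
pose TG := g_sigma_algebraType
  (\bigcup_(u in history_coords k i) preimage_set_system setT u measurable).
have rG : @random_vector R _ TG p (th 0%N).
  by apply: sigma_gen_random_vector; exact: th0_history.
have : measurable_fun [set: TG] (fun t => enorm (th 0%N t - ths) ^+ 2).
  apply: measurable_enorm_sqr; apply: random_vectorB => //.
  exact: random_vector_cst.
move=> /(_ measurableT _ (measurable_itv `]-oo, M%:R])); rewrite setTI.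
by rewrite [X in measurable X -> _](_ : _ = start M).
Qed.

Let moment_step M k i : (i < nR.+1)%N ->
  P.-integrable (start M) (EFin \o r k i) ->
  P.-integrable (start M) (EFin \o r k i.+1) /\
  \int[P]_(t in start M) r k i.+1 t <=
  contraction_factor mu L (beta k) * \int[P]_(t in start M) r k i t + beta k ^+ 2 * nu ^+ 2.
Proof.
move=> iR ir; have [rw [wmean [Z [wvar Zle]]]] := noise k iR.
have tin t : Theta (ti k i t) by apply: ti_in; exact: ltnW.
have rti : random_vector (ti k i) by apply: ti_random; exact: ltnW.
have rG := sigma_gen_random_vector (@ti_history k i).
have iw j : P.-integrable setT (fun t => (w k i t 0 j)%:E) by case: (wmean j).
have iw2 : P.-integrable setT (fun t => (enorm (w k i t) ^+ 2)%:E) by case: wvar.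
have w0 j S : noise_history x th w ti k i S -> (\int[P]_(t in S) (w k i t 0 j)%:E = 0)%E.
  have [_ [_ [_ H]]] := wmean j.
  by move=> /H <-; rewrite integral0_eq.
have -> : r k i.+1 = (fun t => enorm (Defs.proj Theta
    (ti k i t - beta k *: (gh (ti k i t) + w k i t)) - ths) ^+ 2).
  by apply/funext => t; rewrite /r tiS.
split.
  by apply: (learning_moment_integrable Theta0 clTheta cTheta L0 ths_in gh_sc gh_lip
    ths_stat (start_measurable M) tin rti rw iw2 (beta_ge0 k) ir).
have h := (learning_moment_le Theta0 clTheta cTheta L0 ths_in gh_sc gh_lip
    ths_stat (start_measurable M) (@start_history M k i) tin rti rG rw iw w0 iw2
    (beta_ge0 k) ir).
apply: le_trans h _.
rewrite lerD2l ler_wpM2l ?sqr_ge0//.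
apply: cond_exp_le wvar _ Zle; first exact: sqr_ge0.
exact: (@measurableT _ (g_sigma_algebraType
  (\bigcup_(u in history_coords k i) preimage_set_system setT u measurable))).
Qed.

Let start_integrable M : P.-integrable (start M) (EFin \o r 0 0).
Proof.
apply: (le_integrable_norm (start_measurable M) (v := cst M%:R)).
- apply: measurable_funTS; apply: measurable_enorm_sqr.
  by rewrite ti0; exact/random_vectorB/random_vector_cst.
- by move=> t; rewrite /start/= /r ti0 ger0_norm ?sqr_ge0.
exact: finite_measure_integrable_cst.
Qed.

Let moment M k i := \int[P]_(t in start M) r k i t.

Let moment_ge0 M k i : 0 <= moment M k i.
Proof. by apply: Rintegral_ge0 => t _; exact: sqr_ge0. Qed.

Let factor_le1 k : contraction_factor mu L (beta k) <= 1.
Proof.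
have := beta_le k; rewrite ler_pdivlMr ?exprn_gt0// => h.
by have := ler_wpM2l (beta_ge0 k) h; rewrite /contraction_factor; lra.
Qed.

Let moment_inner M k i : (i < nR.+1)%N -> P.-integrable (start M) (EFin \o r k 0) ->
  P.-integrable (start M) (EFin \o r k i.+1) /\
  moment M k i.+1 <= contraction_factor mu L (beta k) * moment M k 0
    + i.+1%:R * (beta k ^+ 2 * nu ^+ 2).
Proof.
move=> + ir0; elim: i => [|i IH] iR.
  by rewrite mulr1n mul1r; exact: moment_step.
have [ir mi] := IH (ltnW iR); have [ir' mi'] := moment_step iR ir.
split=> //; apply: (le_trans mi'); rewrite -(natr1 i.+1) (mulrDl i.+1%:R) (mul1r (_ * _)) addrA lerD2r.
apply: le_trans mi; rewrite -[leRHS]mul1r.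
by rewrite ler_wpM2r// -/(moment M k i.+1) moment_ge0.
Qed.

Let moment_integrable M k : P.-integrable (start M) (EFin \o r k 0).
Proof.
elim: k => [|k IH]; first exact: start_integrable.
have [+ _] := moment_inner (ltnSn nR) IH.
by rewrite (_ : r k.+1 0 = r k nR.+1)//; apply/funext => t; rewrite /r ti0 thS.
Qed.

Let moment_outer M k : moment M k.+1 0 <=
  contraction_factor mu L (beta k) * moment M k 0
  + nR.+1%:R * (beta k ^+ 2 * nu ^+ 2).
Proof.
have [_ +] := moment_inner (ltnSn nR) (@moment_integrable M k).
rewrite (_ : moment M k nR.+1 = moment M k.+1 0)//; congr Rintegral.
by apply/funext => t; rewrite /r ti0 thS.
Qed.

(** The recursion telescopes: each step lowers the moment by
    [beta k * (2 * mu - beta k * L ^+ 2)] times itself, and the bracket is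
    eventually at least [mu]. *)
Let moment_sum M : bounded_sums (fun k => beta k * moment M k 0).
Proof.
pose c k := beta k * (2 * mu - beta k * L ^+ 2) * moment M k 0.
have c0 k : 0 <= c k.
  rewrite !mulr_ge0// subr_ge0.
  by have := beta_le k; rewrite ler_pdivlMr ?exprn_gt0.
have bc : bounded_sums c.
  have [S HS] := beta2_sum.
  exists (moment M 0 0 + nR.+1%:R * nu ^+ 2 * S) => N.
  have : \sum_(0 <= k < N) c k <= moment M 0 0 - moment M N 0
      + nR.+1%:R * nu ^+ 2 * \sum_(0 <= k < N) beta k ^+ 2.
    elim: N => [|N IH]; first by rewrite !big_nil mulr0 addr0 subrr.
    rewrite !big_nat_recr//= mulrDr.
    by have := moment_outer M N; move: IH; rewrite /contraction_factor /c; lra.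
  have : nR.+1%:R * nu ^+ 2 * \sum_(0 <= k < N) beta k ^+ 2 <= nR.+1%:R * nu ^+ 2 * S.
    by rewrite ler_wpM2l// mulr_ge0// sqr_ge0.
  by have := moment_ge0 M N 0; lra.
have e0 : 0 < (mu / L ^+ 2) ^+ 2 by rewrite exprn_gt0// divr_gt0// exprn_gt0.
have [N HN] := bounded_sums_to0 (fun k => sqr_ge0 (beta k)) beta2_sum e0.
have mu1 : 0 <= mu^-1 by rewrite invr_ge0 ltW.
have mc0 k : 0 <= mu^-1 * c k by rewrite mulr_ge0.
apply: (bounded_sums_le_near mc0 (bounded_sumsZ mu1 bc) (N0 := N)) => k /HN.
rewrite ler_pXn2r ?nnegrE ?divr_ge0 ?sqr_ge0 ?(ltW mu0)//.
rewrite ler_pdivlMr ?exprn_gt0// => bk.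
rewrite ler_pdivlMl// /c mulrA ler_wpM2r// mulrC ler_wpM2l//.
by lra.
Qed.

(** On each event [start M] the expectation of the series is finite by
    monotone convergence, hence the series is finite almost surely there; these
    events exhaust the space. *)
Theorem learning_error_summable :
  {ae P, forall t, bounded_sums (fun k => beta k * enorm (th k t - ths) ^+ 2)}.
Proof.
suff H M : {ae P, forall t, start M t ->
    bounded_sums (fun k => beta k * enorm (th k t - ths) ^+ 2)}.
  apply: filterS (ae_foralln H) => t Ht.
  apply: (Ht (Num.bound (enorm (th 0%N t - ths) ^+ 2))).
  by rewrite /start/= ltW// archi_boundP// sqr_ge0.
pose e k t := (beta k * r k 0 t)%:E.
have e0 k t : (0 <= e k t)%E by rewrite lee_fin mulr_ge0// sqr_ge0.
have me k : measurable_fun (start M) (e k).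
  apply/measurable_EFinP; apply: measurable_funM; first exact: measurable_cst.
  apply: measurable_funTS; apply: measurable_enorm_sqr.
  by rewrite ti0; exact/random_vectorB/random_vector_cst.
have ie k : (\int[P]_(t in start M) e k t = (beta k * moment M k 0)%:E)%E.
  rewrite /e; under eq_integral do rewrite EFinM.
  rewrite integralZl//; last exact: moment_integrable.
  rewrite EFinM /moment /Rintegral fineK//.
  by apply: integrable_fin_num => //; exact: moment_integrable.
have isum : P.-integrable (start M) (fun t => (\sum_(0 <= k <oo) e k t)%E).
  apply/integrableP; split.
    by apply: ge0_emeasurable_sum => // k t _ _; exact: e0.
  under eq_integral => t _ do rewrite gee0_abs ?nneseries_ge0//.
  rewrite integral_nneseries//.
  under eq_eseriesr do rewrite ie.
  by apply: bounded_sums_nneseries => // k; rewrite mulr_ge0.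
apply: filterS (integrable_ae (start_measurable M) isum) => t fin /fin.
rewrite ge0_fin_numE ?nneseries_ge0// => lty.
have := bounded_sums_lty (u := fun k => beta k * r k 0 t) _ lty.
rewrite /r; under eq_fun do rewrite ti0.
by apply => k; rewrite mulr_ge0// sqr_ge0.
Qed.

End LearningPath.

(** * The two time scales combined *)

(** The interplay of the two time scales: [gamma k * e k] is at most the mean of
    [gamma k `^ (2 - tau)] and [gamma k `^ tau * e k ^+ 2], since their product
    is its square, and the second term is eventually below [beta k * e k ^+ 2]. *)
Lemma two_timescale_sum {R : realType} (gamma beta e : nat -> R) (tau : R) :
  (forall k, 0 < gamma k) -> (forall k, 0 < beta k) -> (forall k, 0 <= e k) ->
  bounded_sums (fun k => gamma k `^ (2 - tau)) ->
  (fun k => gamma k `^ tau / beta k) @ \oo --> (0 : R) ->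
  bounded_sums (fun k => beta k * e k ^+ 2) ->
  bounded_sums (fun k => gamma k * e k).
Proof.
move=> g0 b0 e0 bg /cvgrPdist_le /(_ 1 ltr01)[N _ HN] be.
apply: (bounded_sums_le_near (N0 := N) _ (bounded_sumsD bg be)).
  by move=> k; rewrite addr_ge0 ?powR_ge0// mulr_ge0 ?sqr_ge0 ?(ltW (b0 k)).
move=> k /HN; rewrite /= sub0r normrN ger0_norm ?divr_ge0 ?powR_ge0 ?(ltW (b0 k))//.
rewrite ler_pdivrMr// mul1r => tb.
set a := gamma k `^ (2 - tau); set b := gamma k `^ tau in tb *.
have ab : a * b = gamma k ^+ 2.
  rewrite /a /b -powRD; last by apply/implyP => _; rewrite gt_eqF.
  by rewrite subrK -powR_mulrn ?ltW.
have a0 : 0 <= a by exact: powR_ge0.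
have bb0 : 0 <= b by exact: powR_ge0.
have be2 : b * e k ^+ 2 <= beta k * e k ^+ 2 by rewrite ler_wpM2r ?sqr_ge0.
have be0 : 0 <= b * e k ^+ 2 by rewrite mulr_ge0 ?sqr_ge0.
suff : gamma k * e k <= a + b * e k ^+ 2 by move=> /le_trans; apply; rewrite lerD2l.
rewrite -(@ler_pXn2r _ 2) ?nnegrE ?addr_ge0 ?mulr_ge0 ?(ltW (g0 k))//.
rewrite exprMn -ab.
have := mulr_ge0 a0 be0; have := sqr_ge0 a; have := sqr_ge0 (b * e k ^+ 2).
lra.
Qed.

Theorem proposition3p7 (R : realType) (n p : nat)
    (X : set 'rV[R]_n) (Theta : set 'rV[R]_p)
    (X_nonempty : X !=set0) (X_closed : closed X)
    (X_convex : convex_set (X : set (convex_lmodType 'rV[R]_n)))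
    (Theta_nonempty : Theta !=set0) (Theta_closed : closed Theta)
    (Theta_convex : convex_set (Theta : set (convex_lmodType 'rV[R]_p)))
    (f : 'rV[R]_n -> 'rV[R]_p -> R) (gf : 'rV[R]_n -> 'rV[R]_p -> 'rV[R]_n)
    (h : 'rV[R]_p -> R) (gh : 'rV[R]_p -> 'rV[R]_p)
    (f_gradient : forall x th, X x -> Theta th ->
       has_gradient X (fun y => f y th) x (gf x th))
    (h_gradient : forall th, Theta th -> has_gradient Theta h th (gh th))
    (f_pseudoconvex : forall th, Theta th ->
       pseudoconvex X (fun y => f y th) (fun y => gf y th))
    (mu_h : R) (mu_h_gt0 : 0 < mu_h)
    (h_strongly_convex : strongly_convex_grad Theta gh mu_h)
    (L_f L_th L_h B : R)
    (L_f_gt0 : 0 < L_f) (L_th_gt0 : 0 < L_th) (L_h_gt0 : 0 < L_h)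
    (B_gt0 : 0 < B)
    (gf_lipschitz_x : forall x1 x2 th, X x1 -> X x2 -> Theta th ->
       enorm (gf x1 th - gf x2 th) <= L_f * enorm (x1 - x2))
    (gf_lipschitz_th : forall x th1 th2, X x -> Theta th1 -> Theta th2 ->
       enorm (gf x th1 - gf x th2) <= L_th * enorm (th1 - th2))
    (gh_lipschitz : forall th1 th2, Theta th1 -> Theta th2 ->
       enorm (gh th1 - gh th2) <= L_h * enorm (th1 - th2))
    (th_star : 'rV[R]_p) (th_star_argmin : is_argmin h Theta th_star)
    (gf_bounded : forall x, X x -> enorm (gf x th_star) <= B)
    (f_min_attained : exists z, is_argmin (fun y => f y th_star) X z)
    (gamma beta : nat -> R)
    (step_sizes : step_size_conditions gamma beta mu_h L_h)
    (nQ nR : nat) (nQ_ge1 : (1 <= nQ)%N) (nR_ge1 : (1 <= nR)%N)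
    (d : measure_display) (T : measurableType d) (P : probability T R)
    (x : nat -> T -> 'rV[R]_n) (th : nat -> T -> 'rV[R]_p)
    (xj xh : nat -> nat -> T -> 'rV[R]_n)
    (w ti : nat -> nat -> T -> 'rV[R]_p)
    (x0_random : random_vector (x 0%N)) (x0_in : forall t, X (x 0%N t))
    (th0_random : random_vector (th 0%N)) (th0_in : forall t, Theta (th 0%N t))
    (scheme : multistep_scheme X Theta gf gh gamma beta nQ nR w x th xj xh ti)
    (nu : R) (nu_gt0 : 0 < nu)
    (noise : noise_conditions P x th w ti nR nu) :
  {ae P, forall t, exists x_star : 'rV[R]_n,
     X x_star /\ (fun k => x k.+1 t) @ \oo --> x_star /\
     forall y, X y -> 0 <= dotv (gf x_star th_star) (y - x_star)}.
Proof.
have [gam0 [beta0 [gam_oo [gam2 [_ [beta2 [beta_le [beta0_le]]]]]]]] := step_sizes.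
move=> [tau [_ [gam_tau tau_lim]]].
have [ths_in ths_min] := th_star_argmin.
have ths_stat := argmin_first_order Theta_convex th_star_argmin (h_gradient _ ths_in).
case: nQ nR nQ_ge1 nR_ge1 scheme noise => [//|Q] [//|Rn] _ _ {}scheme {}noise.
have xj0 k : xj k 0%N = x k by apply/funext => t; have [] := scheme k t.
have ti0 k : ti k 0%N = th k by apply/funext => t; have [_ []] := scheme k t.
have tiS k i : (i < Rn.+1)%N -> ti k i.+1 = (fun t =>
    Defs.proj Theta (ti k i t - beta k *: (gh (ti k i t) + w k i t))).
  by move=> iR; apply/funext => t; have [_ [_ [_ [H _]]]] := scheme k t; exact: H.
have thS k : th k.+1 = ti k Rn.+1.
  by apply/funext => t; have [_ [_ [_ [_ [_ ->]]]]] := scheme k t.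
have th_in k t : Theta (th k t).
  by case: k => // k; rewrite thS tiS//; exact: proj_in.
have b2 := bounded_sums_lty (fun k => sqr_ge0 (beta k)) beta2.
have := learning_error_summable Theta_nonempty Theta_closed Theta_convex
  mu_h_gt0 L_h_gt0 ths_in h_strongly_convex gh_lipschitz ths_stat beta0
  (fun k => le_trans (beta_le k) beta0_le) b2 th0_random th0_in ti0 tiS thS noise.
apply: filterS => t err_sum.
pose e k := enorm (th k t - th_star).
have ge_sum : bounded_sums (fun k => gamma k * (L_th * e k)).
  rewrite (_ : (fun k => _) = (fun k => L_th * (gamma k * e k))); last first.
    by apply/funext => k; rewrite mulrCA.
  apply: bounded_sumsZ; first exact: ltW.
  apply: (two_timescale_sum gam0 beta0 _ _ tau_lim err_sum).
    by move=> k; exact: enorm_ge0.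
  by apply: bounded_sums_lty gam_tau => k; exact: powR_ge0.
have [xbar [Xb xcvg stat]] := extragradient_cvg X_nonempty X_closed X_convex
  (fun y Xy => f_gradient y th_star Xy ths_in) (f_pseudoconvex _ ths_in)
  (fun x1 x2 X1 X2 => gf_lipschitz_x x1 x2 th_star X1 X2 ths_in) gf_bounded
  f_min_attained (G := fun k u => gf u (th k t)) (eps := fun k => L_th * e k)
  (fun k => mulr_ge0 (ltW L_th_gt0) (enorm_ge0 _)) gam0
  (fun k u Xu => gf_lipschitz_th u (th k t) th_star Xu (th_in k t) ths_in)
  (unbounded_sums_eqy (fun k => ltW (gam0 k)) gam_oo)
  (bounded_sums_lty (fun k => sqr_ge0 (gamma k)) gam2) ge_sum
  (Q := Q) (x := fun k => x k t) (xj := fun k j => xj k j t)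
  (xh := fun k j => xh k j t) (x0_in t)
  (fun k => congr1 (fun u => u t) (xj0 k))
  (fun k j jQ => ((scheme k t).2.2.1 j jQ).1)
  (fun k j jQ => ((scheme k t).2.2.1 j jQ).2)
  (fun k => (scheme k t).2.2.2.2.1).
exists xbar; split=> //; split=> //.
by rewrite (cvg_shiftS (fun k => x k t)).
Qed.
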